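(* Let $I$ be a unit square in the plane and let $T$ be an isosceles right triangle whose legs are parallel to the sides of $I$. Let $\{T_n\}$ be a (finite or infinite) collection of homothetic copies of $T$. If $\sum |T_n| \le \frac{1}{2}$, then the triangles from $\{T_n\}$ can be parallel packed into $I$. Moreover, $\varrho(I,T)=\frac{1}{2}$.
   Context: For a plane convex body $C$, $|C|$ denotes its area. A homothetic copy of $C$ is an image of $C$ under a homothety (a scaling by a nonzero ratio followed by a translation). In the packings considered, both translations and $180^\circ$ rotations are allowed: a collection of polygons $\{C_n\}$ can be packed into a plane convex body $D$ if there exist maps $\lambda_n$, each being either a translation or a rotation by $180^\circ$ about some point of the plane, such that all the sets $\lambda_n C_n$ are subsets of $D$ and have pairwise disjoint interiors. The packing of a polygon $D$, one side of which is called its base, is called parallel if each $\lambda_n C_n$ has a side parallel to the base of $D$. Since the maps $\lambda_n$ preserve the directions of sides, this holds automatically here: each copy of $T$ has legs parallel to the sides of $I$. For plane convex bodies $D$ and $C$, $\varrho(D,C)$ denotes the greatest number such that any collection of homothetic copies of $C$ with total area not greater than $\varrho(D,C)\cdot|D|$ can be parallel packed into $D$. *)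

(* Defs.v *)
From HB Require Import structures.
From mathcomp Require Import all_boot all_order all_algebra.
From mathcomp Require Import all_classical all_reals all_analysis.
Set Implicit Arguments.
Unset Strict Implicit.
Unset Printing Implicit Defensive.
Import Order.TTheory GRing.Theory Num.Theory.
Import numFieldNormedType.Exports.

Local Open Scope classical_set_scope.
Local Open Scope ring_scope.

(* The library norm on a product is the max norm, so Euclidean lengths and
   angles are expressed through [dot]; the product topology, hence interiors,
   is nevertheless the Euclidean one. *)
Notation plane R := (R * R)%type.

Section PlaneGeometry.
Context {R : realType}.
Implicit Types (p q u v w a b c : plane R) (C D I T : set (plane R)).

Definition dot u v : R := u.1 * v.1 + u.2 * v.2.

(* For nonzero vectors this is the usual parallelism of directions. *)
Definition parallel u v : Prop := u.1 * v.2 = u.2 * v.1.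

Definition area : set (plane R) -> \bar R :=
  (@lebesgue_measure R \x @lebesgue_measure R)%E.

Definition segment a b : set (plane R) :=
  [set a + t *: (b - a) | t in `[0, 1]].

Definition triangle a b c : set (plane R) :=
  [set x | exists s t : R, [/\ 0 <= s, 0 <= t, s + t <= 1 &
                           x = a + s *: (b - a) + t *: (c - a)]].

Definition unit_square I : Prop :=
  exists p u v, [/\ dot u u = 1, dot v v = 1, dot u v = 0 &
    I = [set x | exists s t : R, [/\ 0 <= s <= 1, 0 <= t <= 1 &
                                 x = p + s *: u + t *: v]]].

(* A side of a convex polygon is a nondegenerate segment cut out by a
   supporting line. *)
Definition side C a b : Prop :=
  a != b /\
  exists w (m : R), [/\ w != 0, (forall x, C x -> dot w x <= m) &
                    C `&` [set x | dot w x = m] = segment a b].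

Definition has_side_parallel_to C v : Prop :=
  exists a b, side C a b /\ parallel (b - a) v.

(* The right angle is at [a]; the legs are [a b] and [a c]. *)
Definition isosceles_right_triangle a b c : Prop :=
  [/\ a != b, dot (b - a) (c - a) = 0 &
      dot (b - a) (b - a) = dot (c - a) (c - a)].

Definition isosceles_right_triangle_along I T : Prop :=
  exists a b c, [/\ isosceles_right_triangle a b c, T = triangle a b c,
    has_side_parallel_to I (b - a) & has_side_parallel_to I (c - a)].

Definition homothetic_copy C C' : Prop :=
  exists (k : R) v, k != 0 /\ C' = [set k *: x + v | x in C].

Definition translation (f : plane R -> plane R) : Prop :=
  exists v, f = fun x => x + v.

Definition half_turn (f : plane R -> plane R) : Prop :=
  exists c, f = fun x => c - (x - c).

(* A finite or infinite collection is a family [C_ n] indexed by the elements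
   [n] of a set [K] of natural numbers; repetitions are allowed.  The base of
   [D] is its side with endpoints [a] and [b]. *)
Definition parallel_packable D a b (K : set nat) (C_ : nat -> set (plane R)) :
    Prop :=
  exists lam : nat -> plane R -> plane R,
    [/\ forall n, K n -> translation (lam n) \/ half_turn (lam n),
        forall n, K n -> lam n @` C_ n `<=` D,
        trivIset K (fun n => interior (lam n @` C_ n)) &
        forall n, K n -> has_side_parallel_to (lam n @` C_ n) (b - a)].

Definition packing_densities D a b C : set R :=
  [set r | forall (K : set nat) (C_ : nat -> set (plane R)),
     (forall n, K n -> homothetic_copy C (C_ n)) ->
     (\esum_(n in K) area (C_ n) <= r%:E * area D)%E ->
     parallel_packable D a b K C_].

(* [r] is the greatest element: the maximum is required to be attained. *)
Definition is_varrho D a b C (r : R) : Prop :=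
  packing_densities D a b C r /\ ubound (packing_densities D a b C) r.

End PlaneGeometry.

(* Main.v *)
Require Import Defs.
From mathcomp Require Import all_boot all_order all_algebra.
From mathcomp Require Import all_classical all_reals all_analysis.
From mathcomp Require Import measurable_realfun.
From mathcomp Require Import ring lra.
Set Implicit Arguments.
Unset Strict Implicit.
Unset Printing Implicit Defensive.
Import Order.TTheory GRing.Theory Num.Theory.
Import numFieldNormedType.Exports.
Local Open Scope classical_set_scope.
Local Open Scope ring_scope.

(** In an orthonormal frame adapted to the square, the square becomes [0,1]^2
    and every triangle of the collection has its legs along the axes and its
    right angle at the bottom left or at the top right ([along_normal_form],
    [homothety_frame_tri]).  Translations and half turns leave both the
    position and the orientation free ([move_tri]), and a triangle with leg s
    has area s^2/2.  So the claim is: if s_0 >= s_1 >= ... >= 0 and the sum of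
    the s_i^2 is at most 1, then triangles with legs s_i, each turned at will,
    fit in [0,1]^2 without overlap ([square_packs]).

    They are placed in decreasing order.  The largest one, with leg s, goes
    into the top right corner.  The others fill rows, from the bottom of the
    square upwards.  A row starts on its base line with the largest remaining
    triangle, whose leg h is the height of the row; then pairs follow: a
    triangle with leg u stands to the right of the last standing one, and its
    successor, with leg v <= u, hangs upside down in the notch between these
    two.  A pair uses the length u of the base line.  When the next triangle,
    with leg q, does not fit in the row, each pair of the row satisfies
    u^2 + v^2 >= u^2 + q^2 >= 2qu, so the row has used at least 2q times the
    length covered by its pairs ([pair_sum]).

    Consider a trapezoid x >= 0, Y <= y <= 1, x + y <= 1 + d with d >= 0, and
    put H = 1 - Y.  Its rows never run out of room if h <= H and the squares of
    the legs sum to at most h^2 + (H-h)^2 + 2d(H-h), where h is the largest leg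
    ([fits]).  Indeed, with H' = H - h, after the first triangle there remains
    at most (H'+d)^2 - d^2; the pairs of the first row cover more than H'+d-q,
    so after the row there remains at most
    (H'+d)^2 - d^2 - 2q(H'+d-q) = q^2 + (H'-q)^2 + 2d(H'-q), which is the same
    condition for the trapezoid above the row ([fits_row_exits]).

    It remains to get past the first row, which has height p = s_1.  Its right
    end may meet the hypotenuse of the largest triangle; three cases arise.
    If s + p <= 1, the row lies below the largest triangle, and one more
    upside-down triangle fits at its right end ([row_exits_separate]).  If
    s + p > 1 and p + s_2 <= 1, at least one pair fits in the row, which gives
    a second lower bound for what the row uses ([row_exits_overlap]).  If
    p + s_2 > 1, the third triangle is hung above the hypotenuse of the second
    one, and the three together already use enough ([fits_three_large]).  In
    each case the rest fits in the trapezoid above the row with d = p, or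
    d = 1 - s in the last two cases.

    The collection may be infinite, so the placement is an endless process,
    and correctness is an invariant relating the free region to the remaining
    legs ([packs_coind]).  A decreasing enumeration exists because only
    finitely many legs exceed a given positive number
    ([sorted_rearrangement]).

    The square may be rotated, so areas have to be computed in a rotated frame.
    Shears preserve the product measure by the section formula, and a rotation
    is a product of three shears ([area_preserving_rotation]).

    The density 1/2 cannot be exceeded because a single triangle of leg larger
    than 1 never fits ([square_density_le]). *)

(** * Packing a decreasing sequence of triangles into a region *)

(** A triangle with legs [s] along the axes and right angle at [c], the top
    right vertex when [up] holds and the bottom left one otherwise. *)
Definition tri {R : realType} (up : bool) (c : plane R) (s : R) : set (plane R) :=
  if up then [set x | [/\ x.1 <= c.1, x.2 <= c.2 & c.1 + c.2 - s <= x.1 + x.2]]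
  else [set x | [/\ c.1 <= x.1, c.2 <= x.2 & x.1 + x.2 <= c.1 + c.2 + s]].

Definition open_tri {R : realType} (up : bool) (c : plane R) (s : R) :
    set (plane R) :=
  if up then [set x | [/\ x.1 < c.1, x.2 < c.2 & c.1 + c.2 - s < x.1 + x.2]]
  else [set x | [/\ c.1 < x.1, c.2 < x.2 & x.1 + x.2 < c.1 + c.2 + s]].

Definition drop_seq {R : realType} (n : nat) (t : nat -> R) : nat -> R :=
  fun i => t (n + i)%N.

(** Disjointness compares the earlier open triangle with the later closed one:
    this is what an invariant on the remaining closed free region delivers, and
    it is more than disjointness of the interiors. *)
Definition packs {R : realType} (F : set (plane R)) (t : nat -> R) : Prop :=
  exists (up : nat -> bool) (c : nat -> plane R),
    (forall i, tri (up i) (c i) (t i) `<=` F) /\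
    (forall i j, (i < j)%N -> forall x,
       open_tri (up i) (c i) (t i) x -> ~ tri (up j) (c j) (t j) x).

(** The first triangle of [t] is placed in the free region [F], and [G] is a
    part of [F] that remains free and suffices for the rest in the sense of
    [P]. *)
Definition pack_step {R : realType} (P : set (plane R) -> (nat -> R) -> Prop)
    (F : set (plane R)) (t : nat -> R) : Prop :=
  exists up c (G : set (plane R)),
    [/\ tri up c (t 0%N) `<=` F, G `<=` F,
        forall x, open_tri up c (t 0%N) x -> ~ G x & P G (drop_seq 1 t)].

Lemma pack_step_mono {R : realType} (P Q : set (plane R) -> (nat -> R) -> Prop)
    (F F' : set (plane R)) (t : nat -> R) :
  F `<=` F' -> (forall G u, P G u -> Q G u) -> pack_step P F t -> pack_step Q F' t.
Proof.
move=> FsubF PQ [up [c [G [h1 h2 h3 h4]]]]; exists up, c, G; split => //.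
- by move=> x /h1 /FsubF.
- by move=> x /h2 /FsubF.
- exact: PQ.
Qed.

(** Coinduction for packings: an invariant between free regions and remaining
    sequences that survives one placement yields, by dependent choice, a packing
    of the whole sequence, because the free regions decrease. *)
Lemma packs_coind1 {R : realType} (P : set (plane R) -> (nat -> R) -> Prop) :
  (forall F t, P F t -> pack_step P F t) -> forall F t, P F t -> packs F t.
Proof.
move=> Pstep F0 t PF0.
have next (nF : nat * set (plane R)) :
    exists ucG : bool * plane R * set (plane R),
      P nF.2 (drop_seq nF.1 t) ->
      [/\ tri ucG.1.1 ucG.1.2 (t nF.1) `<=` nF.2, ucG.2 `<=` nF.2,
          forall x, open_tri ucG.1.1 ucG.1.2 (t nF.1) x -> ~ ucG.2 x &
          P ucG.2 (drop_seq nF.1.+1 t)].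
  case: nF => n F /=; have [PF|nPF] := pselect (P F (drop_seq n t)); last first.
    by exists (true, 0, set0).
  have [up [c [G [h1 h2 h3 h4]]]] := Pstep _ _ PF; exists (up, c, G) => _ /=.
  rewrite /drop_seq addn0 in h1 h3; split => //.
  have -> : drop_seq n.+1 t = drop_seq 1 (drop_seq n t).
    by apply/funext => i; rewrite /drop_seq add1n addnS addSn.
  exact: h4.
have {next}[g gP] := choice next.
pose Fs := fix Fs n := if n is m.+1 then (g (m, Fs m)).2 else F0.
have PFs n : P (Fs n) (drop_seq n t).
  elim: n => [|n IH] /=; last by have [] := gP (n, Fs n) IH.
  by have -> : drop_seq 0 t = t by apply/funext.
have Fs_sub m n : (m <= n)%N -> Fs n `<=` Fs m.
  elim: n => [|n IH]; first by rewrite leqn0 => /eqP ->.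
  rewrite leq_eqVlt => /predU1P[-> //|]; rewrite ltnS => /IH sub x /= Gx.
  by apply: sub; have [_ + _ _] := gP (n, Fs n) (PFs n); apply.
exists (fun n => (g (n, Fs n)).1.1), (fun n => (g (n, Fs n)).1.2); split.
- move=> i x xi; have [+ _ _ _] := gP (i, Fs i) (PFs i) => /(_ x xi) /=.
  exact: (Fs_sub 0%N i).
- move=> i j ij x xi xj; have [_ _ + _] := gP (i, Fs i) (PFs i).
  move=> /(_ x xi); apply; apply: (Fs_sub i.+1 j ij).
  by have [+ _ _ _] := gP (j, Fs j) (PFs j); apply.
Qed.

(** The two triangles of a pair are placed together, so it is convenient that
    the invariant need only hold again after the second one. *)
Lemma packs_coind {R : realType} (P : set (plane R) -> (nat -> R) -> Prop) :
  (forall F t, P F t -> pack_step P F t \/ pack_step (pack_step P) F t) ->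
  forall F t, P F t -> packs F t.
Proof.
move=> Pstep F t PF.
apply: (@packs_coind1 _ (fun G u => P G u \/ pack_step P G u)); last by left.
move=> {t PF}F t [/Pstep[]|]; apply: pack_step_mono => //; by [left|right].
Qed.

Lemma packs_step {R : realType} (F : set (plane R)) (t : nat -> R) :
  pack_step packs F t -> packs F t.
Proof.
move=> [up [c [G [h1 h2 h3 [ups [cs [sub dis]]]]]]].
exists (fun n => if n is m.+1 then ups m else up).
exists (fun n => if n is m.+1 then cs m else c).
split=> [[|i] //|[|i] [|j] // ij x]; last exact: dis.
- by move=> x xi; apply/h2/(sub i).
- by move=> xo xj; apply: (h3 x xo); apply: (sub j).
Qed.

Lemma packs_mono {R : realType} (F G : set (plane R)) (t : nat -> R) :
  F `<=` G -> packs F t -> packs G t.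
Proof.
by move=> FG [ups [c [sub dis]]]; exists ups, c; split=> // i x /sub /FG.
Qed.

Definition descending {R : realType} (t : nat -> R) : Prop :=
  (forall i, 0 <= t i) /\ (forall i, t i.+1 <= t i).

Definition sqsum_le {R : realType} (t : nat -> R) (b : R) : Prop :=
  forall N, \sum_(i < N) t i ^+ 2 <= b.

(** * Rows in a trapezoid *)

(** The part of the strip between heights [Y] and 1 cut off by a line parallel
    to the hypotenuses.  For [d = 1 - s] that line is the hypotenuse of the
    triangle of leg [s] in the top right corner of the unit square. *)
Definition trapezoid {R : realType} (d Y : R) : set (plane R) :=
  [set q | [/\ 0 <= q.1, Y <= q.2, q.2 <= 1 & q.1 + q.2 <= 1 + d]].

(** A sufficient condition for packing [t] into a trapezoid of height [H] whose
    top side has length [d]; it is preserved from each row to the next one. *)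
Definition fits {R : realType} (H d : R) (t : nat -> R) : Prop :=
  t 0%N <= H /\
  sqsum_le t (t 0%N ^+ 2 + (H - t 0%N) ^+ 2 + 2 * d * (H - t 0%N)).

(** What is free in the row of height [h] on the line at height [Y]: the points
    beyond the hypotenuse of the last standing triangle, which ends at [x] on
    that line and starts at [z].  The bound [E] keeps the row below the slanted
    side of its trapezoid, or below the largest triangle. *)
Definition row_rest {R : realType} (Y h x z E : R) : set (plane R) :=
  [set q | [/\ z <= q.1 <= 1, Y <= q.2 <= Y + h, x + Y <= q.1 + q.2 &
              q.1 + q.2 <= E]].

(** When the row, filled up to [x] and of length [l], closes after [n] more
    pairs, what remains fits in the trapezoid above it.  With [e] the triangle
    that no longer fits as a standing one is hung at the right end of the row,
    so that one triangle more has been used. *)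
Definition row_exits {R : realType} (e : bool) (l H d x : R) (t : nat -> R) :
    Prop :=
  forall n, l < x + \sum_(i < n) t i.*2 + t n.*2 ->
    fits H d (drop_seq (n.*2 + e) t).

(** The free part of a row while it is being filled: the next triangle is no
    larger than the last standing one, which has leg [x - z], and no larger than
    the row is high, so its turned companion has room in the notch. *)
Record row_state {R : realType} (e : bool) (d Y h x z l E : R) (t : nat -> R)
    : Prop := RowState {
  row_d : 0 <= d <= Y + h;
  row_Y : 0 <= Y;
  row_top : Y + h <= 1;
  row_z : 0 <= z;
  row_gap : z + t 0%N <= x;
  row_h : t 0%N <= h;
  row_x : x <= 1;
  row_l : l <= 1;
  row_E : Y + l <= E;
  row_extra : e -> Y + h + 1 <= E;
  row_exit : row_exits e l (1 - (Y + h)) d x t }.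

(** The invariant of the filling process: either a new row is about to start in
    a trapezoid, or a row is under way below the trapezoid kept for later. *)
Inductive filling {R : realType} (F : set (plane R)) (t : nat -> R) : Prop :=
| FillTrapezoid d Y of 0 <= d <= Y & F = trapezoid d Y & fits (1 - Y) d t
| FillRow e d Y h x z l E of row_state e d Y h x z l E t &
    F = trapezoid d (Y + h) `|` row_rest Y h x z E.

Lemma descending_drop {R : realType} n (t : nat -> R) :
  descending t -> descending (drop_seq n t).
Proof.
by move=> [t0 td]; split=> i; rewrite /drop_seq ?addnS.
Qed.

Lemma descending_le {R : realType} (t : nat -> R) : descending t ->
  forall i j, (i <= j)%N -> t j <= t i.
Proof.
move=> [t0 td] i; elim=> [|j IH]; first by rewrite leqn0 => /eqP ->.
by rewrite leq_eqVlt => /predU1P[-> //|]; rewrite ltnS => /IH; apply: le_trans.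
Qed.

(** For a pair of legs [u >= v], and a later leg [q <= v], one has
    [u^2 + v^2 >= u^2 + q^2 >= 2 q u]: the area that a row has used is at least
    proportional to the length that its pairs cover. *)
Lemma pair_sum {R : realType} (t : nat -> R) (n : nat) : descending t ->
  2 * t n.*2 * \sum_(i < n) t i.*2 <= \sum_(i < n.*2) t i ^+ 2.
Proof.
move=> tD; elim: n => [|n IH]; first by rewrite !big_ord0 mulr0.
rewrite doubleS !big_ord_recr /=.
have h1 : t n.*2.+2 <= t n.*2.+1 by apply: descending_le.
have h2 : t n.*2.+1 <= t n.*2 by apply: descending_le.
have h3 : 0 <= \sum_(i < n) t i.*2 by apply: sumr_ge0 => i _; apply tD.1.
have h4 : 0 <= t n.*2.+2 by apply tD.1.
move: IH h1 h2 h3 h4.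
set S := \sum_(i < n) _; set Q := \sum_(i < n.*2) _.
set u := t n.*2; set v := t n.*2.+1; set q := t n.*2.+2 => IH h1 h2 h3 h4.
have : 2 * q * S <= 2 * u * S by apply: ler_wpM2r => //; lra.
have : q ^+ 2 <= v ^+ 2 by rewrite !expr2; apply: ler_pM.
have : 0 <= (q - u) ^+ 2 by apply: sqr_ge0.
rewrite !expr2; lra.
Qed.

Lemma sqsum_drop {R : realType} (t : nat -> R) (n : nat) (b : R) :
  sqsum_le t b -> sqsum_le (drop_seq n t) (b - \sum_(i < n) t i ^+ 2).
Proof.
move=> tb N; rewrite lerBrDl; apply: le_trans (tb (n + N)%N).
by rewrite big_split_ord /=.
Qed.

Lemma sqsum_ge1 {R : realType} (t : nat -> R) (b : R) :
  sqsum_le t b -> t 0%N ^+ 2 <= b.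
Proof. by move=> /(_ 1%N); rewrite big_ord1. Qed.

Lemma sqsum_weak {R : realType} (t : nat -> R) (b b' : R) :
  sqsum_le t b -> b <= b' -> sqsum_le t b'.
Proof. by move=> tb bb' N; apply: le_trans (tb N) bb'. Qed.

Lemma drop_seqD {R : realType} m n (t : nat -> R) :
  drop_seq m (drop_seq n t) = drop_seq (n + m) t.
Proof. by apply/funext => i; rewrite /drop_seq addnA. Qed.

(** The budget in [fits] reproduces itself.  With [H' = H - h] and [q] the first
    leg that does not fit, the row has used [h^2] and at least [2q(H'+d-q)], and
    [(H'+d)^2 - d^2 - 2q(H'+d-q) = q^2 + (H'-q)^2 + 2d(H'-q)].  If [q] exceeded
    [H'], what remains would be less than [q^2]. *)
Lemma fits_row_exits {R : realType} (H d : R) (t : nat -> R) :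
  0 <= d -> descending t -> fits H d t ->
  row_exits false (H + d) (H - t 0%N) d (t 0%N) (drop_seq 1 t).
Proof.
move=> d0 tD [hH tb] n; rewrite addn0.
have [t0 _] := tD.
have uD := descending_drop 1 tD; have := pair_sum n uD.
have := sqsum_drop n.*2 (sqsum_drop 1 tb); rewrite big_ord1 /=.
have X0 : 0 <= \sum_(i < n) drop_seq 1 t i.*2 by apply: sumr_ge0 => i _; apply: t0.
set u := drop_seq 1 t in uD X0 *; rewrite /fits.
have -> : drop_seq n.*2 u 0%N = u n.*2 by rewrite /drop_seq addn0.
have q0 : 0 <= u n.*2 by apply uD.1.
move: X0 q0 hH {tb}.
set h := t 0%N; set q := u n.*2; set X := \sum_(i < n) u i.*2.
set S := \sum_(i < n.*2) _ => X0 q0 hH sb SX lt_l.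
have key : (q * (H - h + d - q) <= q * X).
  by apply: ler_wpM2l => //; lra.
have qH : q <= H - h.
  rewrite leNgt; apply/negP => Hq.
  have := sqsum_ge1 sb.
  have -> : drop_seq n.*2 u 0%N = q by rewrite /drop_seq addn0.
  rewrite !expr2 => sq.
  nra.
split=> //; apply: sqsum_weak sb _; rewrite !expr2 in SX key *; nra.
Qed.

(** The head of the sequence opens a new row of its own height at the left end
    of the trapezoid; the slanted side leaves a row of length [1 - Y + d]. *)
Lemma trapezoid_step {R : realType} (d Y : R) (t : nat -> R) :
  descending t -> 0 <= d <= Y -> fits (1 - Y) d t ->
  pack_step (fun F u => descending u /\ filling F u) (trapezoid d Y) t.
Proof.
move=> tD /andP[d0 dY] tfit; have [t0 tS] := tD; have [tH _] := tfit.
have t00 := t0 0%N; have t10 := t0 1%N; have t01 := tS 0%N.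
exists false, (0, Y), (trapezoid d (Y + t 0%N) `|` row_rest Y (t 0%N) (t 0%N) 0 (1 + d)).
split.
- by move=> [X y] /= [h1 h2 h3]; split => /=; lra.
- move=> [X y] /= [[/= h1 h2 h3 h4]|[/= /andP[h1 h2] /andP[h3 h4] h5 h6]];
    by split => /=; lra.
- move=> [X y] /= [h1 h2 h3] [[/= h4 h5 h6 h7]|[/= _ _ h4 _]]; lra.
split; first exact: descending_drop.
apply: (@FillRow _ _ _ false d Y (t 0%N) (t 0%N) 0 (1 - Y + d) (1 + d)) => //.
split; rewrite /drop_seq ?addn0 ?add0r //; try by [lra | apply/andP; split; lra].
have -> : 1 - (Y + t 0%N) = 1 - Y - t 0%N by lra.
exact: fits_row_exits.
Qed.

Lemma row_exits_next {R : realType} (e : bool) (l H d x : R) (t : nat -> R) :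
  row_exits e l H d x t -> row_exits e l H d (x + t 0%N) (drop_seq 2 t).
Proof.
move=> ex n hn; rewrite drop_seqD.
have -> : (2 + (n.*2 + e) = n.+1.*2 + e)%N by rewrite doubleS.
apply: ex; rewrite big_ord_recl /=; rewrite addrA.
by move: hn; under eq_bigr do rewrite /drop_seq.
Qed.

(** A pair: the standing triangle with leg [u] occupies the base from [x] to
    [x + u], and the next one is hung with its right angle at [(x, Y + u)], so
    that its hypotenuse faces that of the previous standing triangle. *)
Lemma row_step {R : realType} (e : bool) (d Y h x z l E : R) (t : nat -> R) :
  descending t -> row_state e d Y h x z l E t -> x + t 0%N <= l ->
  pack_step (pack_step (fun F u => descending u /\ filling F u))
    (trapezoid d (Y + h) `|` row_rest Y h x z E) t.
Proof.
move=> tD [/andP[d0 dY] Y0 Yh z0 zx th x1 l1 YE Ee ex] xl; have [t0 tS] := tD.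
have t00 := t0 0%N; have t10 := t0 1%N; have t01 := tS 0%N.
have t12 := tS 1%N; have t20 := t0 2%N.
pose u := t 0%N; pose v := t 1%N.
(* Between the two placements the notch left of [x] is free as well. *)
exists false, (x, Y), (trapezoid d (Y + h) `|`
  ([set q | [/\ z <= q.1 <= x, Y <= q.2 <= Y + h, x + Y <= q.1 + q.2 &
                q.1 + q.2 <= E]] `|` row_rest Y h (x + u) x E)).
split.
- move=> [X y] /= [h1 h2 h3]; right.
  by split => /=; rewrite /u in h3 *; [apply/andP; split| apply/andP; split | |]; lra.
- move=> [X y] /= [h1|[[/= /andP[h1 h2] /andP[h3 h4] h5 h6]|
     [/= /andP[h1 h2] /andP[h3 h4] h5 h6]]]; [by left| |]; right; rewrite /u in h5 *;
    by split => /=; [apply/andP; split| apply/andP; split | |]; lra.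
- move=> [X y] /= [h1 h2 h3] [[/= _ h4 _ _]|[[/= /andP[_ h4] _ _ _]|
    [/= _ _ h4 _]]]; rewrite /u in h4; lra.
exists true, (x, Y + u), (trapezoid d (Y + h) `|` row_rest Y h (x + u) x E).
rewrite -[drop_seq 1 t 0%N]/v drop_seqD; split.
- move=> [X y] /= [h1 h2 h3]; right; left; rewrite /u /v in h2 h3 *.
  by split => /=; [apply/andP; split| apply/andP; split | |]; lra.
- by move=> q [h1|h1]; [left|right; right].
- move=> [X y] /= [h1 h2 h3] [[/= _ h4 _ _]|[/= /andP[h4 _] _ _ _]];
    rewrite /u in h2; lra.
split; first exact: descending_drop.
apply: (@FillRow _ _ _ e d Y h (x + u) x l E) => //.
split; rewrite /drop_seq ?addn0 /u //; try by [lra | apply/andP; split; lra].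
exact: row_exits_next.
Qed.

Lemma filling_step {R : realType} (F : set (plane R)) (t : nat -> R) :
  descending t /\ filling F t ->
  let P F u := descending u /\ filling F u in
  pack_step P F t \/ pack_step (pack_step P) F t.
Proof.
move=> [tD []].
  by move=> d Y dY -> tfit; left; apply: trapezoid_step.
move=> e d Y h x z l E st ->.
have [xl|lx] := leP (x + t 0%N) l; first by right; apply: row_step st xl.
left; case: st => dY Y0 Yh z0 zx th x1 l1 YE Ee ex.
have {ex} := ex 0%N; rewrite big_ord0 addr0 add0n => /(_ lx).
case: e Ee => [/(_ isT) Ee | _] /= tfit; last first.
  by apply: pack_step_mono (trapezoid_step tD dY tfit) => //; left.
have [t0 tS] := tD; have t00 := t0 0%N.
(* The extra triangle at the right end of the row. *)
exists true, (1, Y + h), (trapezoid d (Y + h)); split.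
- move=> [X y] /= [h1 h2 h3]; right.
  by split => /=; [apply/andP; split| apply/andP; split | |]; lra.
- by move=> q hq; left.
- move=> [X y] /= [h1 h2 h3] [/= _ h4 _ _]; lra.
split; first exact: descending_drop.
exact: FillTrapezoid tfit.
Qed.

Lemma filling_packs {R : realType} (F : set (plane R)) (t : nat -> R) :
  descending t -> filling F t -> packs F t.
Proof.
move=> tD tF; apply: (packs_coind (@filling_step R)); exact: conj tD tF.
Qed.

(** * The unit square *)
Definition std_square {R : realType} : set (plane R) :=
  [set q | 0 <= q.1 <= 1 /\ 0 <= q.2 <= 1].

(** [s] and [p] are the legs of the two largest triangles, and [U] lists the
    other legs; the triangle of leg [p] opens the first row. *)
Section FirstRow.
Variables (R : realType) (t : nat -> R).
Hypotheses (tD : descending t) (tb : sqsum_le t 1).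
Let s := t 0%N.
Let p := t 1%N.
Let U := drop_seq 2 t.

Lemma sqsum_drop2 : sqsum_le U (1 - (s ^+ 2 + p ^+ 2)).
Proof. by have := sqsum_drop 2 tb; rewrite big_ord_recr big_ord1. Qed.

Lemma head_bounds : [/\ 0 <= p, p <= s, s ^+ 2 + p ^+ 2 <= 1 & s <= 1].
Proof.
have p0 : 0 <= p by apply tD.1.
have ps : p <= s by apply tD.2.
have := tb 2%N; rewrite big_ord_recr big_ord1 /= -/s -/p => sp1.
by split=> //; rewrite !expr2 in sp1; nra.
Qed.

Lemma third_on_le i : U i <= p.
Proof. by rewrite /U /drop_seq; apply: descending_le. Qed.

(** Let [u] be the leg that no longer fits and [q] the next one.  The row uses
    at least [2u(1-p-u) + u^2] besides [p^2], which is increasing in [u] for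
    [u <= 1 - p] and may thus be bounded at [u = q]; what remains to be shown is
    [(s^2 - p^2) + (p - q)^2 >= 0]. *)
Lemma row_exits_separate : s + p <= 1 -> row_exits true 1 (1 - p) p p U.
Proof.
move=> sp n; rewrite addn1 => ln.
have [p0 ps _ _] := head_bounds.
have UD : descending U by exact: descending_drop.
have := sqsum_drop n.*2.+1 sqsum_drop2; have := pair_sum n UD.
rewrite big_ord_recr /= /fits.
have -> : drop_seq n.*2.+1 U 0%N = U n.*2.+1 by rewrite /drop_seq addn0.
have X0 : 0 <= \sum_(i < n) U i.*2 by apply: sumr_ge0 => i _; apply UD.1.
have qu : U n.*2.+1 <= U n.*2 by apply UD.2.
have q0 : 0 <= U n.*2.+1 by apply UD.1.
have up : U n.*2 <= p by exact: third_on_le.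
move: ln X0 qu q0 up.
set X := \sum_(i < n) _; set S := \sum_(i < _) _.
set u := U n.*2; set q := U n.*2.+1 => ln X0 qu q0 up SX sb.
have qp : q <= 1 - p by lra.
split=> //; apply: sqsum_weak sb _; rewrite !expr2.
have h1 : u * (1 - p - u) <= u * X by apply: ler_wpM2l; lra.
have h2 : 0 <= (u - q) * (2 - 2 * p - u - q) by apply: mulr_ge0; lra.
have h3 : 0 <= (p - q) ^+ 2 by apply: sqr_ge0.
have h4 : p * p <= s * s by apply: ler_pM.
rewrite expr2 in h3; lra.
Qed.

(** Let [q] be the leg that no longer fits, [a = 1 - p] and [X] the length
    covered by the pairs.  The pairs use at least [2qX >= 2q(a-q)], and also at
    least [2q^2] since [p + t 2 <= 1] guarantees a pair; the better bound depends
    on whether [q <= a/2].  The resulting expression increases with [s], so it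
    suffices to treat the least possible value [s = max(p, a)]. *)
Lemma row_exits_overlap : 1 < s + p -> p + t 2%N <= 1 ->
  row_exits false 1 (1 - p) (1 - s) p U.
Proof.
move=> sp pt n; rewrite addn0 => ln.
have [p0 ps _ s1] := head_bounds.
have UD : descending U by exact: descending_drop.
have SX := pair_sum n UD; have := sqsum_drop n.*2 sqsum_drop2.
rewrite /fits.
have -> : drop_seq n.*2 U 0%N = U n.*2 by rewrite /drop_seq addn0.
have X0 : 0 <= \sum_(i < n) U i.*2 by apply: sumr_ge0 => i _; apply UD.1.
have q0 : 0 <= U n.*2 by apply UD.1.
have qt : U n.*2 <= t 2%N by apply: (@descending_le _ t tD 2 (2 + n.*2)).
have S2 : 2 * U n.*2 ^+ 2 <= \sum_(i < n.*2) U i ^+ 2.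
  case: n ln {SX X0 qt} q0 => [|n] ln q0.
    by move: ln; rewrite big_ord0 addr0 /U /drop_seq /= => ln; lra.
  rewrite doubleS 2!big_ord_recr /=.
  have qv : U n.*2.+2 <= U n.*2.+1 by apply UD.2.
  have vu : U n.*2.+1 <= U n.*2 by apply UD.2.
  have qu : U n.*2.+2 <= U n.*2 by apply: le_trans vu.
  have : 0 <= \sum_(i < n.*2) U i ^+ 2 by apply: sumr_ge0 => i _; apply: sqr_ge0.
  have : U n.*2.+2 ^+ 2 <= U n.*2.+1 ^+ 2.
    by rewrite !expr2; apply: ler_pM.
  have : U n.*2.+2 ^+ 2 <= U n.*2 ^+ 2.
    by rewrite !expr2; apply: ler_pM.
  by lra.
move: ln X0 qt q0 SX S2.
set X := \sum_(i < n) _; set S := \sum_(i < _) _.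
set q := U n.*2 => ln X0 qt q0 SX S2 sb.
split; first lra.
have h1 : q * (1 - p - q) <= q * X by apply: ler_wpM2l; lra.
apply: sqsum_weak sb _; rewrite !expr2 in S2 *.
have rs : 0 <= 1 - p - q by lra.
have [a ae] : exists a, a = 1 - p by exists (1 - p).
(* [h2] below lowers [s] to [a] when [p <= 1/2], and to [p] otherwise. *)
suff : 1 <= s * s + p * p + S + q * q + (a - q) * (a - q) + 2 * (1 - s) * (a - q).
  by subst a; lra.
have [p12|p12] := leP p (1 / 2).
  have h2 : 0 <= (s - a) * (s + a - 2 * (a - q)) by apply: mulr_ge0; lra.
  have [qa|qa] := leP q (a / 2).
    have h3 : 0 <= (a / 2 - q) * p by apply: mulr_ge0; lra.
    have h4 : 0 <= (1 / 2 - p) * (1 - p) by apply: mulr_ge0; lra.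
    subst a; lra.
  have h3 : 0 <= (q - a / 2) * (q + a / 2 - 1 / 2) by apply: mulr_ge0; lra.
  have h4 : 0 <= (1 / 2 - p) * (1 - p) by apply: mulr_ge0; lra.
  subst a; lra.
have h2 : 0 <= (s - p) * (s + p - 2 * (a - q)) by apply: mulr_ge0; lra.
have h4 : 0 <= (p - 1 / 2) * (p - 1 / 2) by apply: mulr_ge0; lra.
have [qa|qa] := leP q (a / 2).
  have h3 : 0 <= (a / 2 - q) * a by apply: mulr_ge0; lra.
  subst a; lra.
have h3 : 0 <= (q - a / 2) * (q - a / 2) by apply: mulr_ge0; lra.
subst a; lra.
Qed.

(** Here [s >= p >= t 2 > 1 - p].  With [a = 1 - p] and [z = t 3], lowering [s]
    to [p] and [t 2] to [a] reduces the budget condition to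
    [2p^2 + 2a^2 + 2(a-z)^2 >= 1], which holds as [p + a = 1].  The bound on the
    sum of the three legs follows from that on the sum of their squares, and
    makes room for the third triangle. *)
Lemma fits_three_large : 1 < p + t 2%N ->
  [/\ s + p + t 2%N <= 2 & fits (1 - p) (1 - s) (drop_seq 3 t)].
Proof.
have [p0 ps _ s1] := head_bounds; have [t0 tS] := tD.
have qp : t 2%N <= p := tS 1%N; have zq : t 3%N <= t 2%N := tS 2%N.
have z0 := t0 3%N.
have := sqsum_drop 3 tb; rewrite !big_ord_recr big_ord0 /= add0r -/s -/p.
have := tb 3%N; rewrite !big_ord_recr big_ord0 /= add0r -/s -/p /fits.
have -> : drop_seq 3 t 0%N = t 3%N by rewrite /drop_seq addn0.
move: qp zq z0; set q := t 2%N; set z := t 3%N => qp zq z0 spq sb pq.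
have [a ae] : exists a, a = 1 - p by exists (1 - p).
have aq : a * a <= q * q by apply: ler_pM; lra.
have h4 : 0 <= (p - 1 / 2) * (p - 1 / 2) by apply: mulr_ge0; lra.
have h5 : p * p <= s * s by apply: ler_pM.
have za : z <= a.
  rewrite leNgt; apply/negP => az.
  have := sqsum_ge1 sb; rewrite /drop_seq -/z !expr2 => zs.
  have h6 : a * a < z * z by apply: ltr_pM; lra.
  subst a; lra.
rewrite !expr2 in spq; split.
  have h1 := sqr_ge0 (s - p); have h2 := sqr_ge0 (s - q).
  have h3 := sqr_ge0 (p - q).
  have h6 : (s + p + q) * (s + p + q) <= 3 by rewrite !expr2 in h1 h2 h3; lra.
  rewrite leNgt; apply/negP => h7.
  have : 2 * 2 < (s + p + q) * (s + p + q) by apply: ltr_pM; lra.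
  lra.
split; first by lra.
apply: sqsum_weak sb _; rewrite !expr2.
have h2 : 0 <= (s - p) * (s + p - 2 * (a - z)) by apply: mulr_ge0; lra.
have h3 := sqr_ge0 (a - z); rewrite expr2 in h3.
subst a; lra.
Qed.

End FirstRow.

Theorem square_packs {R : realType} (t : nat -> R) :
  descending t -> sqsum_le t 1 -> packs std_square t.
Proof.
move=> tD tb; have [p0 ps sp1 s1] := head_bounds tD tb.
have [t0 tS] := tD; have q0 := t0 2%N; have qp := tS 1%N.
move: p0 ps s1 q0 qp (row_exits_separate tD tb) (row_exits_overlap tD tb)
  (fits_three_large tD tb).
set s := t 0%N; set p := t 1%N; set q := t 2%N.
move=> p0 ps s1 q0 qp case1 case2 case3.
have tD2 := descending_drop 2 tD; have tD3 := descending_drop 3 tD.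
apply: packs_step; exists true, (1, 1),
  [set x | [/\ 0 <= x.1 <= 1, 0 <= x.2 <= 1 & x.1 + x.2 <= 2 - s]].
split; rewrite -/s.
- by move=> [X y] /= [h1 h2 h3]; split => /=; apply/andP; split; lra.
- by move=> [X y] [].
- by move=> [X y] /= [h1 h2 h3] [_ _]; lra.
apply: packs_step; exists false, (0, 0),
  [set x | [/\ 0 <= x.1 <= 1, 0 <= x.2 <= 1, p <= x.1 + x.2 & x.1 + x.2 <= 2 - s]].
rewrite -[drop_seq 1 t 0%N]/p drop_seqD; split.
- by move=> [X y] /= [h1 h2 h3]; split => /=; [apply/andP; split..|]; lra.
- by move=> [X y] [].
- by move=> [X y] /= [h1 h2 h3] [_ _]; lra.
rewrite -[(1 + 1)%N]/2%N.
have [sp|sp] := leP (s + p) 1.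
  apply: (@packs_mono _ (trapezoid p (0 + p) `|` row_rest 0 p p 0 (1 + p))).
    move=> [X y] /= [[/= h1 h2 h3 h4]|[/= /andP[h1 h2] /andP[h3 h4] h5 h6]];
      by split => /=; [apply/andP; split; lra..|lra|lra].
  apply: filling_packs => //.
  apply: (@FillRow _ _ _ true p 0 p p 0 1 (1 + p)) => //.
  split; rewrite /drop_seq ?addn0 ?add0r //; try by [lra | apply/andP; split; lra].
  exact: case1.
have [pq|pq] := leP (p + q) 1.
  apply: (@packs_mono _ (trapezoid (1 - s) (0 + p) `|` row_rest 0 p p 0 1)).
    move=> [X y] /= [[/= h1 h2 h3 h4]|[/= /andP[h1 h2] /andP[h3 h4] h5 h6]];
      by split => /=; [apply/andP; split; lra..|lra|lra].
  apply: filling_packs => //.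
  apply: (@FillRow _ _ _ false (1 - s) 0 p p 0 1 1) => //.
  split; rewrite /drop_seq ?addn0 ?add0r //; try by [lra | apply/andP; split; lra].
  exact: case2.
have [spq tfit] := case3 pq.
(* The hypotenuse of the third triangle lies on that of the second one, starting
   at its upper left end. *)
apply: packs_step; exists true, (q, p), (trapezoid (1 - s) p).
rewrite -[drop_seq 2 t 0%N]/q drop_seqD; split.
- by move=> [X y] /= [h1 h2 h3]; split => /=; [apply/andP; split; lra..|lra|lra].
- by move=> [X y] [/= h1 h2 h3 h4]; split => /=; [apply/andP; split; lra..|lra|lra].
- by move=> [X y] /= [h1 h2 h3] [/= _ h4 _ _]; lra.
apply: filling_packs => //.
by apply: FillTrapezoid tfit => //; apply/andP; split; lra.
Qed.

(** * Decreasing enumeration of a square-summable family *)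

(** Since the squares are summable, only finitely many terms are at least as
    large as a given one.  Hence a largest remaining term always exists, and
    repeatedly removing one exhausts [K].  If [K] is finite the sequence goes on
    with zeros, which stand for degenerate triangles. *)
Lemma sorted_rearrangement {R : realType} (K : set nat) (a : nat -> R) (b : R) :
  0 <= b -> (forall n, K n -> 0 < a n) ->
  (forall s : seq nat, uniq s -> (forall n, n \in s -> K n) ->
     \sum_(n <- s) a n ^+ 2 <= b) ->
  exists (t : nat -> R) (rho : nat -> nat),
    [/\ descending t, sqsum_le t b, forall n, K n -> t (rho n) = a n &
        forall m n, K m -> K n -> rho m = rho n -> m = n].
Proof.
move=> b0 apos asum.
have bounded n0 : K n0 -> exists N : nat, forall s : seq nat, uniq s ->
    (forall n, n \in s -> K n /\ a n0 <= a n) -> (size s < N)%N.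
  move=> Kn0; have c0 : 0 < a n0 ^+ 2 by rewrite exprn_gt0 // apos.
  have q0 : 0 <= b / a n0 ^+ 2 by rewrite divr_ge0 // ltW.
  exists (Num.bound (b / a n0 ^+ 2)) => s su sK; rewrite -(ltr_nat R).
  apply: le_lt_trans (archi_boundP q0); rewrite ler_pdivlMr //.
  apply: le_trans (asum s su _); last by move=> n /sK[].
  have -> : (size s)%:R * a n0 ^+ 2 = \sum_(n <- s) a n0 ^+ 2.
    by rewrite big_const_seq count_predT iter_addr_0 mulr_natl.
  rewrite big_seq [leRHS]big_seq.
  apply: ler_sum => n /sK[Kn an]; rewrite !expr2.
  by apply: ler_pM => //; apply/ltW/apos.
have max (S : set nat) : exists m, S `<=` K -> S !=set0 ->
    S m /\ forall n, S n -> a n <= a m.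
  have [SK|] := pselect (S `<=` K); last by exists 0%N.
  have [[n0 Sn0]|] := pselect (S !=set0); last by exists 0%N.
  apply: contrapT => nomax.
  have next m : S m -> exists n, S n /\ a m < a n.
    move=> Sm; apply: contrapT => no; apply: nomax; exists m => _ _.
    split=> // n Sn; rewrite leNgt; apply/negP => lt; apply: no; by exists n.
  have [N hN] := bounded n0 (SK _ Sn0).
(* Without a maximum there are arbitrarily long chains of increasing terms,
   listed here with the largest one first. *)
  have [s [su sS sN]] : exists s : seq nat, [/\ uniq s,
      forall n, n \in s -> [/\ S n, a n0 <= a n & a n <= a (head n0 s)] & size s = N.+1].
    elim: (N) => [|k [s [su sS sk]]].
      by exists [:: n0]; split=> // n; rewrite inE => /eqP ->.
    case: s su sS sk => // x s su sS sk.
    have [Sx ax _] := sS x (mem_head _ _).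
    have [y [Sy xy]] := next x Sx.
    exists (y :: x :: s); split; last by rewrite /= -sk.
    - rewrite cons_uniq su andbT; apply/negP => /sS[_ _ /=].
      by rewrite leNgt xy.
    - move=> n; rewrite inE => /orP[/eqP ->|/sS[Sn an nx]].
        by split=> //; apply: le_trans ax (ltW xy).
      by split=> //; apply: le_trans nx (ltW xy).
  have := hN s su; rewrite sN ltnNge leqnSn => /(_ _)/negP; apply=> //.
  by move=> n /sS[/SK].
have {max}[sel selP] := choice max.
pose rest := fix rest k := if k is j.+1 then [set n | rest j n /\ n <> sel (rest j)] else K.
have restK k : rest k `<=` K by elim: k => [//|k IH] n /= [/IH].
have rest_sub j k : (j <= k)%N -> rest k `<=` rest j.
  elim: k => [|k IH]; first by rewrite leqn0 => /eqP ->.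
  by rewrite leq_eqVlt => /predU1P[-> //|]; rewrite ltnS => /IH sub n /= [/sub].
pose pick k := sel (rest k).
have pickP k : rest k !=set0 -> rest k (pick k) /\ forall n, rest k n -> a n <= a (pick k).
  by apply: selP; exact: restK.
have pick_inj j k : rest j !=set0 -> rest k !=set0 -> pick j = pick k -> j = k.
  move=> /pickP[pj _] /pickP[pk _] E.
  have [jk|kj|//] := ltngtP j k.
    by have /= [_] := rest_sub _ _ jk _ pk; rewrite -/(pick j) E.
  by have /= [_] := rest_sub _ _ kj _ pj; rewrite -/(pick k) E.
pose t k : R := if `[< rest k !=set0 >] then a (pick k) else 0.
have tE k : rest k !=set0 -> t k = a (pick k) by move=> ne; rewrite /t asboolT.
have tE0 k : ~ (rest k !=set0) -> t k = 0 by move=> ne; rewrite /t asboolF.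
have t0 k : 0 <= t k.
  have [ne|ne] := pselect (rest k !=set0); last by rewrite tE0.
  by rewrite tE //; have [pk _] := pickP k ne; exact/ltW/apos/(restK k).
have found n : K n -> exists k, rest k n /\ pick k = n.
  move=> Kn; apply: contrapT => no.
  have always k : rest k n.
    elim: k => [//|k IH] /=; split=> // E; apply: no; exists k; by split.
  have [N hN] := bounded n Kn.
  have := hN [seq pick k | k <- iota 0 N]; rewrite size_map size_iota ltnn.
  move=> h; apply/negP: isT; apply: h.
    rewrite map_inj_uniq ?iota_uniq // => j k.
    by apply: pick_inj; exists n.
  move=> m /mapP[k _ ->]; have [pk le] := pickP k (ex_intro _ n (always k)).
  split; [exact: restK pk|exact: le].
have {found}/choice[rho rhoP] n : exists k, K n -> rest k n /\ pick k = n.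
  have [/found[k kP]|nK] := pselect (K n); first by exists k.
  by exists 0%N.
exists t, rho; split.
- split=> // k; have [ne|ne] := pselect (rest k.+1 !=set0); last by rewrite tE0.
  have [/= [pk _] _] := pickP _ ne.
  have nk : rest k !=set0 by exists (pick k.+1).
  by rewrite (tE k nk) (tE _ ne); apply: (pickP k nk).2.
- move=> N.
  pose s := [seq pick k | k <- iota 0 N & `[< rest k !=set0 >]].
  have <- : \sum_(n <- s) a n ^+ 2 = \sum_(i < N) t i ^+ 2.
    rewrite big_map big_filter big_mkcond -(big_mkord predT (fun i => t i ^+ 2)) /=.
    rewrite /index_iota subn0; apply: eq_bigr => k _; rewrite /t.
    by case: ifP; rewrite // expr0n.
  apply: asum.
    rewrite map_inj_in_uniq ?filter_uniq ?iota_uniq // => j k.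
    rewrite !mem_filter => /andP[/asboolP nj _] /andP[/asboolP nk _].
    exact: pick_inj.
  move=> n /mapP[k]; rewrite mem_filter => /andP[/asboolP nk _] ->.
  by apply: (restK k); case: (pickP k nk).
- move=> n /rhoP[rn pn]; rewrite tE ?pn //; by exists n.
- by move=> m n /rhoP[_ pm] /rhoP[_ pn] E; rewrite -pm -pn E.
Qed.

(** * Invariance of the area under rotations *)
Section AreaPreserving.
Context {R : realType}.
Local Notation mR := (measurableTypeR R).
Local Notation mu := (@lebesgue_measure R).

Lemma lebesgue_measure_shift (e : R) (A : set mR) : measurable A ->
  mu ((fun y => y + e) @^-1` A) = mu A.
Proof.
move=> mA.
have mf : measurable_fun setT ((fun y => y + e) : mR -> mR).
  exact: measurable_funD.
rewrite -[LHS]/(pushforward mu ((fun y => y + e) : mR -> mR) A).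
apply/esym/(@lebesgue_measure_unique R (pushforward mu ((fun y => y + e) : mR -> mR))) => //= _ [[a b]] _ <-.
rewrite /pushforward.
have -> : (fun y => y + e) @^-1` `]a, b] = `]a - e, b - e]%classic.
  by apply/seteqP; split=> y /=; rewrite !in_itv /= => /andP[h1 h2];
    apply/andP; split; lra.
rewrite !lebesgue_measure_itv /= !lte_fin ltrD2r.
by case: ifP => // _; rewrite -!EFinD; congr (_%:E); lra.
Qed.

Definition area_preserving (f : plane R -> plane R) : Prop :=
  measurable_fun (setT : set (mR * mR)) (f : mR * mR -> mR * mR) /\
  forall A : set (mR * mR), measurable A -> area (f @^-1` A) = area A.

Lemma area_preserving_comp (f g : plane R -> plane R) :
  area_preserving f -> area_preserving g -> area_preserving (f \o g).
Proof.
move=> [mf af] [mg ag]; split; first exact: (measurableT_comp mf mg).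
move=> A mA; rewrite comp_preimage ag ?af //.
by rewrite -[X in measurable X]setTI; apply: mf.
Qed.

(** Each vertical section is translated, so its length does not change. *)
Lemma area_preserving_shear (c e : R) :
  area_preserving (fun q => (q.1, q.2 + (c * q.1 + e))).
Proof.
split.
  apply: measurable_fun_pair; first exact: measurable_fst.
  apply: measurable_funD; first exact: measurable_snd.
  apply: measurable_funD; last exact: measurable_cst.
  apply: measurable_funM; [exact: measurable_cst|exact: measurable_fst].
move=> A mA; apply: eq_integral => x _ /=.
rewrite -(@lebesgue_measure_shift (c * x + e) (xsection A x)); last first.
  exact: measurable_xsection.
by congr (mu _); apply/seteqP; split=> y; rewrite /xsection /= !inE.
Qed.

Lemma area_preserving_swap : area_preserving (fun q => (q.2, q.1)).
Proof.
have ms : measurable_fun (setT : set (mR * mR))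
    ((fun q => (q.2, q.1)) : mR * mR -> mR * mR).
  by apply: measurable_fun_pair; [exact: measurable_snd|exact: measurable_fst].
split=> // A mA; apply/esym.
apply: (@product_measure_unique _ _ _ _ _ mu mu
  (pushforward (mu \x mu)%E ((fun q => (q.2, q.1)) : mR * mR -> mR * mR))) => // B C mB mC.
have e : (fun q : mR * mR => (q.2, q.1)) @^-1` (B `*` C) = C `*` B.
  by apply/seteqP; split=> [] [x y] [].
rewrite -[LHS]/((mu \x mu)%E ((fun q : mR * mR => (q.2, q.1)) @^-1` (B `*` C))) e.
by rewrite product_measure1E // muleC.
Qed.

Lemma area_preserving_shear2 (c e : R) :
  area_preserving (fun q => (q.1 + (c * q.2 + e), q.2)).
Proof.
exact: (area_preserving_comp area_preserving_swap
  (area_preserving_comp (area_preserving_shear c e) area_preserving_swap)).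
Qed.

(** For [d <> 0] a rotation is a product of three shears with coefficients
    [a], [-d], [a], where [a = (1 - c) / d].  The remaining rotations are the
    identity and the half turn, which is the square of a quarter turn. *)
Lemma area_preserving_rotation (c d : R) : c ^+ 2 + d ^+ 2 = 1 ->
  area_preserving (fun q => (c * q.1 + d * q.2, - d * q.1 + c * q.2)).
Proof.
have rot c' d' : d' != 0 -> c' ^+ 2 + d' ^+ 2 = 1 ->
    area_preserving (fun q => (c' * q.1 + d' * q.2, - d' * q.1 + c' * q.2)).
  move=> d0 cd; pose a := (1 - c') / d'.
  have ad : a * d' = 1 - c' by rewrite /a divfK.
  have ac : a * (1 + c') = d'.
    have dd : d' * d' = 1 - c' ^+ 2 by rewrite -cd; ring.
    by apply: (mulIf d0); rewrite mulrAC ad dd; ring.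
  rewrite (_ : (fun _ => _) = (fun q => (q.1 + (a * q.2 + 0), q.2)) \o
    ((fun q => (q.1, q.2 + (- d' * q.1 + 0))) \o
     (fun q => (q.1 + (a * q.2 + 0), q.2)))); last first.
    apply/funext => -[x y] /=.
    have e1 : - d' * x + c' * y = y + (- d' * (x + (a * y + 0)) + 0).
      have -> : c' = 1 - a * d' by rewrite ad; ring.
      by ring.
    rewrite -e1; congr pair.
    transitivity (x - a * d' * x + a * (1 + c') * y); last by ring.
    by rewrite ad ac; ring.
  apply: area_preserving_comp; first exact: area_preserving_shear2.
  apply: area_preserving_comp; last exact: area_preserving_shear2.
  exact: area_preserving_shear.
move=> cd; have [d0|] := eqVneq d 0; last by move=> d0; apply: rot.
have : (c - 1) * (c + 1) = 0 by move: cd; rewrite d0; move=> h; lra.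
move/eqP; rewrite mulf_eq0 => /orP[/eqP c1|/eqP c1].
  have := area_preserving_shear 0 0; congr area_preserving.
  apply/funext => -[x y] /=; have -> : c = 1 by lra.
  by rewrite d0; congr pair; ring.
have r1 := rot 0 1 (oner_neq0 R) ltac:(by rewrite expr0n /= expr1n add0r).
have := area_preserving_comp r1 r1; congr area_preserving.
apply/funext => -[x y] /=; have -> : c = -1 by lra.
by rewrite d0; congr pair; ring.
Qed.

Lemma measurable_halfplane (f : mR * mR -> R) (b : R) :
  measurable_fun setT f -> measurable [set q | f q <= b].
Proof.
move=> mf; rewrite (_ : [set q | _] = setT `&` f @^-1` `]-oo, b]%classic).
  by apply: mf => //; exact: measurable_itv.
by apply/seteqP; split=> q /=; rewrite in_itv /=; [|case].
Qed.

Lemma measurable_tri (s : R) : measurable (tri false (0, 0) s : set (mR * mR)).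
Proof.
rewrite (_ : tri _ _ _ = [set q : mR * mR | - q.1 <= 0] `&`
   ([set q : mR * mR | - q.2 <= 0] `&` [set q : mR * mR | q.1 + q.2 <= s])).
  apply: measurableI; [|apply: measurableI]; apply: measurable_halfplane.
  - by apply: measurable_funN; exact: measurable_fst.
  - by apply: measurable_funN; exact: measurable_snd.
  - by apply: measurable_funD; [exact: measurable_fst|exact: measurable_snd].
by apply/seteqP; split=> -[x y] /=; rewrite !oppr_le0 !add0r; [case|case=> ? []].
Qed.

(** The section at [x] is the segment from 0 to [s - x]. *)
Lemma area_std_tri (s : R) : 0 < s ->
  area (tri false (0, 0) s) = (s ^+ 2 / 2)%:E.
Proof.
move=> s0; rewrite /area /product_measure1.
transitivity (\int[mu]_(x in `[0%R, s]) (s - x)%:E)%E.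
  rewrite [RHS]integral_mkcond; apply: eq_integral => x _ /=.
  rewrite patchE; case: ifPn => [/set_mem | /negP nx].
    rewrite /= in_itv /= => /andP[x0 xs].
    rewrite (_ : xsection _ _ = `[0, s - x]%classic).
      rewrite lebesgue_measure_itv /= lte_fin; case: ifPn.
        by rewrite -EFinB subr0.
      by rewrite -leNgt => h; congr (_%:E); lra.
    apply/seteqP; split=> y; rewrite /xsection /= in_itv /=.
      by move=> /set_mem[/= h1 h2 h3]; apply/andP; split; lra.
    by move=> /andP[h1 h2]; apply/mem_set; split => /=; lra.
  rewrite (_ : xsection _ _ = set0) ?measure0 //.
  apply/seteqP; split=> y //; rewrite /xsection /= => /set_mem[/= h1 h2 h3].
  by apply: nx; apply/mem_set; rewrite /= in_itv /=; apply/andP; split; lra.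
pose F := fun x : R => s * x - x ^+ 2 / 2.
have dF (x : R) : is_derive x 1 F (s - x).
  rewrite /F; apply: is_derive_eq; rewrite /GRing.scale /=.
  by lra.
have cF (x : R) : {for x, continuous F}.
  apply: differentiable_continuous; apply/derivable1_diffP.
  by have [] := dF x.
rewrite (@continuous_FTC2 R (fun x => s - x) F 0 s) //.
- by rewrite /F -EFinB; congr (_%:E); rewrite expr0n /=; lra.
- apply: continuous_subspaceT => x.
  by apply: cvgB; [exact: cvg_cst|exact: cvg_id].
- split.
  + by move=> x _; have [] := dF x.
  + exact: cvg_at_right_filter (cF 0).
  + exact: cvg_at_left_filter (cF s).
- by move=> x _; rewrite derive1E; have [_ ->] := dF x.
Qed.

End AreaPreserving.

(** * Orthonormal frames *)
Definition frame {R : realType} (p u v q : plane R) : plane R :=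
  p + q.1 *: u + q.2 *: v.

Definition orthonormal {R : realType} (u v : plane R) : Prop :=
  [/\ dot u u = 1, dot v v = 1 & dot u v = 0].

Lemma plane_eq {R : realType} (x y : plane R) : x.1 = y.1 -> x.2 = y.2 -> x = y.
Proof. by case: x y => [x1 x2] [y1 y2] /= -> ->. Qed.

Lemma dotC {R : realType} (x y : plane R) : dot x y = dot y x.
Proof. by rewrite /dot; ring. Qed.

Lemma dotNl {R : realType} (x y : plane R) : dot (- x) y = - dot x y.
Proof. by rewrite /dot /=; ring. Qed.

Lemma dotDl {R : realType} (x y z : plane R) :
  dot (x + y) z = dot x z + dot y z.
Proof. by rewrite /dot /=; ring. Qed.

Lemma frameE {R : realType} (p u v q : plane R) : frame p u v q =
  (p.1 + q.1 * u.1 + q.2 * v.1, p.2 + q.1 * u.2 + q.2 * v.2).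
Proof. by []. Qed.

Section Frame.
Context {R : realType} (p u v : plane R) (uv : orthonormal u v).
Local Notation mR := (measurableTypeR R).

Definition coords (x : plane R) : plane R := (dot u (x - p), dot v (x - p)).

Lemma orthonormal_swap : orthonormal v u.
Proof. by case: uv => uu vv uv0; split=> //; rewrite -uv0 /dot; ring. Qed.

Lemma frameK : cancel (frame p u v) coords.
Proof.
move=> q; case: uv; rewrite /dot => uu vv uv0; apply: plane_eq; rewrite /= /dot /=.
  transitivity (q.1 * (u.1 * u.1 + u.2 * u.2) + q.2 * (u.1 * v.1 + u.2 * v.2)).
    by rewrite /GRing.scale /=; ring.
  by rewrite uu uv0; ring.
transitivity (q.1 * (u.1 * v.1 + u.2 * v.2) + q.2 * (v.1 * v.1 + v.2 * v.2)).
  by rewrite /GRing.scale /=; ring.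
by rewrite vv uv0; ring.
Qed.

(** The determinant [D] of the frame satisfies [D^2 = 1]. *)
Lemma orthonormal_perp :
  v = (- u.2, u.1) \/ v = (u.2, - u.1).
Proof.
case: uv; rewrite /dot => uu vv uv0.
pose D := u.1 * v.2 - u.2 * v.1.
have v1 : v.1 = - u.2 * D.
  rewrite -[LHS]mul1r -uu -[LHS]subr0 -(mulr0 u.1) -uv0 /D; ring.
have v2 : v.2 = u.1 * D.
  rewrite -[LHS]mul1r -uu -[LHS]subr0 -(mulr0 u.2) -uv0 /D; ring.
have : (D - 1) * (D + 1) = 0.
  transitivity ((u.1 * u.1 + u.2 * u.2) * D ^+ 2 - 1); first by rewrite uu; ring.
  by rewrite -vv v1 v2; ring.
move/eqP; rewrite mulf_eq0 => /orP[/eqP D1|/eqP D1]; [left|right];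
  apply: plane_eq; rewrite /= ?v1 ?v2.
- have -> : D = 1 by lra. by ring.
- have -> : D = 1 by lra. by ring.
- have -> : D = -1 by lra. by ring.
- have -> : D = -1 by lra. by ring.
Qed.

Lemma coordsK : cancel coords (frame p u v).
Proof.
move=> x; case: uv; rewrite /dot => uu _ _.
have scl (a b : R) : a = (u.1 * u.1 + u.2 * u.2) * (a - b) + b by rewrite uu; ring.
rewrite frameE /coords /dot /=.
by have [-> | ->] := orthonormal_perp; apply: plane_eq => /=;
  [rewrite [RHS](scl x.1 p.1)|rewrite [RHS](scl x.2 p.2)|
   rewrite [RHS](scl x.1 p.1)|rewrite [RHS](scl x.2 p.2)]; ring.
Qed.

Lemma frame_image (A : set (plane R)) : frame p u v @` A = coords @^-1` A.
Proof.
apply/seteqP; split=> x /=; first by case=> q Aq <-; rewrite frameK.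
by move=> Ax; exists (coords x) => //; rewrite coordsK.
Qed.

Lemma dot_frame (w q : plane R) :
  dot w (frame p u v q) = dot w p + q.1 * dot w u + q.2 * dot w v.
Proof. by rewrite frameE /dot /=; ring. Qed.

Lemma dot_u_frame (q : plane R) : dot u (frame p u v q) = dot u p + q.1.
Proof. by case: uv => uu _ uv0; rewrite dot_frame uu uv0; ring. Qed.

Lemma dot_v_frame (q : plane R) : dot v (frame p u v q) = dot v p + q.2.
Proof. by case: uv => _ vv uv0; rewrite dot_frame vv [dot v u]dotC uv0; ring. Qed.
End Frame.

(** A positively oriented frame is a rotation after a translation; a negatively
    oriented one becomes positive when its two axes are exchanged. *)
Lemma area_preserving_coords {R : realType} (p u v : plane R) :
  orthonormal u v -> area_preserving (coords p u v).
Proof.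
have pos (u' v' : plane R) : dot u' u' = 1 -> v' = (- u'.2, u'.1) ->
    area_preserving (coords p u' v').
  rewrite /dot => uu ->.
  have cd : u'.1 ^+ 2 + u'.2 ^+ 2 = 1 by rewrite !expr2.
  have := area_preserving_comp (area_preserving_rotation cd)
    (area_preserving_comp (area_preserving_shear 0 (- p.2))
      (area_preserving_shear2 0 (- p.1))).
  congr area_preserving; apply/funext => x.
  by apply: plane_eq; rewrite /coords /dot /=; ring.
move=> uv; have [uu vv uv0] := uv.
have [ve|ve] := orthonormal_perp uv; first exact: pos.
have ue : u = (- v.2, v.1) by rewrite ve /= opprK; case: (u).
have := area_preserving_comp (area_preserving_swap (R := R)) (pos _ _ vv ue).
by congr area_preserving; apply/funext => x.
Qed.

Lemma area_frame {R : realType} (p u v : plane R)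
    (A : set (measurableTypeR R * measurableTypeR R)) :
  orthonormal u v -> measurable A -> area (frame p u v @` A) = area A.
Proof.
move=> uv mA; rewrite (frame_image p uv).
by have [_ ->] := area_preserving_coords p uv.
Qed.

Lemma orthonormalN {R : realType} (u v : plane R) : orthonormal u v ->
  orthonormal (- u) (- v).
Proof. by rewrite /orthonormal /dot /= !mulrNN. Qed.

(** Moving the origin to the right angle, and reversing both axes if the
    triangle hangs, reduces every triangle to the standard one. *)
Lemma area_frame_tri {R : realType} (p u v : plane R) up c (s : R) :
  orthonormal u v -> 0 < s -> area (frame p u v @` tri up c s) = (s ^+ 2 / 2)%:E.
Proof.
move=> uv s0; rewrite -area_std_tri //.
pose sg (x : plane R) := if up then - x else x.
have uv' : orthonormal (sg u) (sg v).
  by rewrite /sg; case: (up) => //; apply: orthonormalN.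
rewrite -(area_frame (frame p u v c) uv' (measurable_tri s)); congr area.
rewrite /sg; case: (up); apply/seteqP; split=> x /= [q [h1 h2 h3] <-].
- exists (c.1 - q.1, c.2 - q.2); first by split => /=; lra.
  by rewrite !frameE; apply: plane_eq => /=; ring.
- exists (c.1 - q.1, c.2 - q.2); first by move: h1 h2 h3 => /= *; split => /=; lra.
  by rewrite !frameE; apply: plane_eq => /=; ring.
- exists (q.1 - c.1, q.2 - c.2); first by split => /=; lra.
  by rewrite !frameE; apply: plane_eq => /=; ring.
- exists (q.1 + c.1, q.2 + c.2); first by move: h1 h2 h3 => /= *; split => /=; lra.
  by rewrite !frameE; apply: plane_eq => /=; ring.
Qed.

Lemma area_frame_square {R : realType} (p u v : plane R) :
  orthonormal u v -> area (frame p u v @` std_square) = 1%E.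
Proof.
move=> uv.
have e : @std_square R = `[0, 1]%classic `*` `[0, 1]%classic.
  by apply/seteqP; split=> q /=; rewrite !in_itv.
rewrite e area_frame //; last by apply: measurableX; exact: measurable_itv.
have l1 : @lebesgue_measure R `[0, 1]%classic = 1%E.
  by rewrite lebesgue_measure_itv /= lte_fin ltr01 -EFinB subr0.
rewrite -[RHS]mule1 -{1}l1 -l1.
by apply: product_measure1E; exact: measurable_itv.
Qed.

(** * Sides and interiors in a frame *)
Section FrameGeometry.
Context {R : realType} (p u v : plane R) (uv : orthonormal u v).

Lemma frame_sub (q r : plane R) :
  frame p u v q - frame p u v r = (q.1 - r.1) *: u + (q.2 - r.2) *: v.
Proof. by rewrite !frameE; apply: plane_eq; rewrite /= /GRing.scale /=; ring. Qed.

Lemma dot_sub_frame (q r : plane R) :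
  dot u (frame p u v q - frame p u v r) = q.1 - r.1 /\
  dot v (frame p u v q - frame p u v r) = q.2 - r.2.
Proof.
have e (w a b : plane R) : dot w (a - b) = dot w a - dot w b.
  by rewrite /dot /=; ring.
by rewrite !e !(dot_u_frame _ uv) !(dot_v_frame _ uv); split; ring.
Qed.

Lemma segmentl (a b : plane R) : segment a b a.
Proof.
exists 0; first by rewrite /= in_itv /= lexx ler01.
by rewrite scale0r addr0.
Qed.

Lemma segmentr (a b : plane R) : segment a b b.
Proof.
exists 1; first by rewrite /= in_itv /= lexx ler01.
by rewrite scale1r addrC subrK.
Qed.

(** If the supporting functional [w] varies along [u], its maximum over the
    square is attained only at one value of the first coordinate, so the side is
    orthogonal to [u].  Otherwise [w] varies along [v]. *)
Lemma side_square (a b : plane R) : side (frame p u v @` std_square) a b ->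
  dot u (b - a) = 0 \/ dot v (b - a) = 0.
Proof.
move=> [_ [w [m [w0 wle wseg]]]].
have [[a' [ha1 ha2] <-] wa] : (frame p u v @` std_square `&` [set x | dot w x = m]) a.
  by rewrite wseg; exact: segmentl.
have [[b' [hb1 hb2] <-] wb] : (frame p u v @` std_square `&` [set x | dot w x = m]) b.
  by rewrite wseg; exact: segmentr.
have le q : std_square q -> dot w p + q.1 * dot w u + q.2 * dot w v <= m.
  by move=> hq; rewrite -dot_frame; apply: wle; exists q.
move: wa wb => /=; rewrite !dot_frame => wa wb.
have [-> ->] := dot_sub_frame b' a'.
have := le (1, a'.2); have := le (0, a'.2); have := le (1, b'.2); have := le (0, b'.2).
have := le (a'.1, 1); have := le (a'.1, 0); have := le (b'.1, 1); have := le (b'.1, 0).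
rewrite /std_square /= !ler01 !lexx ha1 ha2 hb1 hb2.
move=> /(_ (conj isT isT)) l1 /(_ (conj isT isT)) l2 /(_ (conj isT isT)) l3.
move=> /(_ (conj isT isT)) l4 /(_ (conj isT isT)) l5 /(_ (conj isT isT)) l6.
move=> /(_ (conj isT isT)) l7 /(_ (conj isT isT)) l8.
move: ha1 ha2 hb1 hb2 => /andP[? ?] /andP[? ?] /andP[? ?] /andP[? ?].
have [u0|u0|u0] := ltgtP (dot w u) 0.
- left; have : a'.1 <= 0 by nra. have : b'.1 <= 0 by nra. lra.
- left; have : 1 <= a'.1 by nra. have : 1 <= b'.1 by nra. lra.
have [v0|v0|v0] := ltgtP (dot w v) 0.
- right; have : a'.2 <= 0 by nra. have : b'.2 <= 0 by nra. lra.
- right; have : 1 <= a'.2 by nra. have : 1 <= b'.2 by nra. lra.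
case/eqP: w0; rewrite -(coordsK 0 uv w) /coords subr0.
by rewrite [dot u w]dotC u0 [dot v w]dotC v0 frameE; apply: plane_eq => /=; rewrite !mul0r !addr0.
Qed.

Lemma dot_eq0_parallel (w x y : plane R) :
  w != 0 -> x != 0 -> dot w x = 0 -> parallel x y -> dot w y = 0.
Proof.
move=> w0 x0; rewrite /dot /parallel => wx xy.
have e1 : x.1 * (w.1 * y.1 + w.2 * y.2) = 0.
  transitivity (y.1 * (w.1 * x.1 + w.2 * x.2) + w.2 * (x.1 * y.2 - x.2 * y.1)).
    by ring.
  by rewrite wx xy; ring.
have e2 : x.2 * (w.1 * y.1 + w.2 * y.2) = 0.
  transitivity (y.2 * (w.1 * x.1 + w.2 * x.2) - w.1 * (x.1 * y.2 - x.2 * y.1)).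
    by ring.
  by rewrite wx xy; ring.
move/eqP: e1; rewrite mulf_eq0 => /orP[/eqP x1|/eqP //].
move/eqP: e2; rewrite mulf_eq0 => /orP[/eqP x2|/eqP //].
by case/eqP: x0; apply: plane_eq.
Qed.

Lemma dot_unit_neq0 (w : plane R) : dot w w = 1 -> w != 0.
Proof.
move=> ww; apply/eqP => w0; move: ww; rewrite w0 /dot /= !mul0r addr0 => /eqP.
by rewrite eq_sym oner_eq0.
Qed.

Lemma has_side_parallel_square (w : plane R) :
  has_side_parallel_to (frame p u v @` std_square) w -> dot u w = 0 \/ dot v w = 0.
Proof.
move=> [a [b [ab par]]]; have [uu vv _] := uv.
have ba : b - a != 0 by rewrite subr_eq0 eq_sym; case: ab.
have [d0|d0] := side_square ab; [left|right];
  by apply: (dot_eq0_parallel _ ba d0 par); apply: dot_unit_neq0.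
Qed.

Lemma segment_frame (a b : plane R) :
  segment (frame p u v a) (frame p u v b) = frame p u v @` segment a b.
Proof.
have e t : frame p u v a + t *: (frame p u v b - frame p u v a) =
    frame p u v (a + t *: (b - a)).
  by rewrite !frameE; apply: plane_eq; rewrite /= /GRing.scale /=; ring.
apply/seteqP; split=> x /=.
  by move=> [t ht <-]; exists (a + t *: (b - a)); rewrite ?e //; exists t.
by move=> [_ [t ht <-] <-]; exists t.
Qed.

Lemma tri_leg1 up (c : plane R) (s : R) (q : plane R) : 0 < s ->
  (tri up c s q /\ q.2 = c.2) <->
  segment c (c.1 + (if up then - s else s), c.2) q.
Proof.
move=> s0; have ratio y : 0 <= y -> y <= s -> exists2 t, 0 <= t <= 1 & t * s = y.
  move=> y0 ys; exists (y / s); last by rewrite divfK // gt_eqF.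
  by rewrite divr_ge0 ?(ltW s0) //= ler_pdivrMr // mul1r.
case: up; split.
- move=> [[/= h1 h2 h3] q2]; have [||t t01 ts] := ratio (c.1 - q.1); [lra..|].
  exists t; first by rewrite /= in_itv.
  by apply: plane_eq; rewrite /= /GRing.scale /=; lra.
- move=> [t + <-]; rewrite /= in_itv /= /GRing.scale /= => /andP[t0 t1].
  by split; [split|]; rewrite ?subrr ?mulr0; nra.
- move=> [[/= h1 h2 h3] q2]; have [||t t01 ts] := ratio (q.1 - c.1); [lra..|].
  exists t; first by rewrite /= in_itv.
  by apply: plane_eq; rewrite /= /GRing.scale /=; lra.
- move=> [t + <-]; rewrite /= in_itv /= /GRing.scale /= => /andP[t0 t1].
  by split; [split|]; rewrite ?subrr ?mulr0; nra.
Qed.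

Lemma flip_tri up (c : plane R) (s : R) (q : plane R) :
  tri up c s q -> tri up (c.2, c.1) s (q.2, q.1).
Proof. by case: up => -[/= h1 h2 h3]; split => //=; lra. Qed.

Lemma flip_segment (a b q : plane R) :
  segment a b q -> segment (a.2, a.1) (b.2, b.1) (q.2, q.1).
Proof. by move=> [t ht <-]; exists t. Qed.

Lemma tri_leg2 up (c : plane R) (s : R) (q : plane R) : 0 < s ->
  (tri up c s q /\ q.1 = c.1) <->
  segment c (c.1, c.2 + (if up then - s else s)) q.
Proof.
move=> s0; have leg := tri_leg1 up (c.2, c.1) (q.2, q.1) s0; split.
  move=> [/flip_tri qt q1]; have /leg/flip_segment := conj qt q1.
  by case: (c) (q) => [? ?] [? ?].
move=> /flip_segment/leg[/flip_tri qt q1].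
by split=> //; move: qt; case: (c) (q) => [? ?] [? ?].
Qed.

(** Both legs are sides of the triangle, cut out by the coordinate lines through
    the right angle. *)
Lemma side_tri up (c : plane R) (s : R) : 0 < s ->
  let e := if up then - s else s in
  side (frame p u v @` tri up c s) (frame p u v c) (frame p u v (c.1 + e, c.2)) /\
  side (frame p u v @` tri up c s) (frame p u v c) (frame p u v (c.1, c.2 + e)).
Proof.
move=> s0 e; have [uu vv uv0] := uv.
have e0 : e != 0 by rewrite /e; case: (up); rewrite ?oppr_eq0 gt_eqF.
have finj := can_inj (frameK p uv).
split; (split; first by apply/eqP => /finj E; move/eqP: e0; apply;
     move: (congr1 fst E) (congr1 snd E) => /=; lra); rewrite segment_frame.
- exists (if up then v else - v), (if up then dot v p + c.2 else - dot v p - c.2).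
  split; first by case: (up); rewrite ?oppr_eq0 dot_unit_neq0.
    by move=> _ [q + <-]; case: (up); move=> [/= h1 h2 h3]; rewrite ?dotNl (dot_v_frame p uv); lra.
  apply/seteqP; split=> x /=.
    move=> [[q qt <-] E]; exists q => //; apply/tri_leg1 => //; split=> //.
    by move: E; case: (up); rewrite ?dotNl (dot_v_frame p uv); lra.
  move=> [q /(tri_leg1 _ _ _ s0)[qt q2] <-]; split; first by exists q.
  by case: (up); rewrite ?dotNl (dot_v_frame p uv) q2; lra.
- exists (if up then u else - u), (if up then dot u p + c.1 else - dot u p - c.1).
  split; first by case: (up); rewrite ?oppr_eq0 dot_unit_neq0.
    by move=> _ [q + <-]; case: (up); move=> [/= h1 h2 h3]; rewrite ?dotNl (dot_u_frame p uv); lra.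
  apply/seteqP; split=> x /=.
    move=> [[q qt <-] E]; exists q => //; apply/tri_leg2 => //; split=> //.
    by move: E; case: (up); rewrite ?dotNl (dot_u_frame p uv); lra.
  move=> [q /(tri_leg2 _ _ _ s0)[qt q2] <-]; split; first by exists q.
  by case: (up); rewrite ?dotNl (dot_u_frame p uv) q2; lra.
Qed.

(** In the plane, being orthogonal to one vector of the frame means being
    parallel to the other one. *)
Lemma parallel_of_dot_eq0 (x : plane R) : dot u x = 0 \/ dot v x = 0 ->
  parallel v x \/ parallel u x.
Proof.
rewrite /dot /parallel; have [-> | ->] /= := orthonormal_perp uv.
  by case=> h; [left|right]; lra.
by case=> h; [left|right]; lra.
Qed.

Lemma has_side_parallel_tri up (c : plane R) (s : R) (w : plane R) :
  0 < s -> dot u w = 0 \/ dot v w = 0 ->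
  has_side_parallel_to (frame p u v @` tri up c s) w.
Proof.
move=> s0 /parallel_of_dot_eq0 uw; have := side_tri up c s0.
set e : R := if up then - s else s => /= -[side1 side2].
case: uw => par; [exists (frame p u v c), (frame p u v (c.1, c.2 + e))|
  exists (frame p u v c), (frame p u v (c.1 + e, c.2))]; split=> //;
  rewrite frame_sub /parallel /= /GRing.scale /= in par *.
- transitivity (e * (v.1 * w.2)); first by ring.
  by rewrite par; ring.
- transitivity (e * (u.1 * w.2)); first by ring.
  by rewrite par; ring.
Qed.

(** From an interior point one can still move a little in the direction [w]. *)
Lemma interior_lt (C : set (plane R)) (w x : plane R) (m : R) : w != 0 ->
  (forall y, C y -> dot w y <= m) -> interior C x -> dot w x < m.
Proof.
move=> w0 Cle Cx.
have cf : {for 0, continuous (fun t : R => x + t *: w)}.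
  by apply: cvgD; [exact: cvg_cst|apply: cvgZl; exact: cvg_id].
have : nbhs (0 : R) ((fun t : R => x + t *: w) @^-1` C).
  by apply: cf; rewrite scale0r addr0.
move=> /nbhs_ballP[e /= e0 he].
have /Cle : C (x + (e / 2) *: w).
  apply: he; rewrite /ball /= sub0r normrN gtr0_norm; lra.
have ww : 0 < dot w w.
  rewrite lt_def; apply/andP; split; last first.
    by rewrite /dot; apply: addr_ge0; rewrite -expr2 sqr_ge0.
  apply: contra w0; rewrite /dot paddr_eq0 -?expr2 ?sqr_ge0 // !sqrf_eq0.
  by move=> /andP[/eqP h1 /eqP h2]; apply/eqP; apply: plane_eq.
have -> : dot w (x + (e / 2) *: w) = dot w x + e / 2 * dot w w.
  by rewrite /dot /= /GRing.scale /=; ring.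
have : 0 < e / 2 * dot w w by apply: mulr_gt0 => //; lra.
lra.
Qed.

Lemma interior_tri up (c : plane R) (s : R) :
  interior (frame p u v @` tri up c s) `<=` frame p u v @` open_tri up c s.
Proof.
move=> X xi; have [uu vv uv0] := uv.
have [q qt qX] := interior_subset xi; exists q => //.
have u0 := dot_unit_neq0 uu; have v0 := dot_unit_neq0 vv.
have uv1 : u + v != 0.
  apply/eqP => E; have : dot (u + v) u = 0 by rewrite E /dot /= !mul0r addr0.
  by rewrite dotDl uu [dot v u]dotC uv0 addr0 => /eqP; rewrite oner_eq0.
have lt w m : w != 0 -> (forall r, tri up c s r -> dot w (frame p u v r) <= m) ->
    dot w (frame p u v q) < m.
  by move=> w0 hw; rewrite qX; apply: interior_lt xi => // _ [r rt <-]; apply: hw.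
case: up {qt xi} lt => lt /=.
- have := lt _ (dot u p + c.1) u0; have := lt _ (dot v p + c.2) v0.
  have := lt (- (u + v)) (- dot u p - dot v p - (c.1 + c.2 - s)).
  rewrite oppr_eq0 !dotNl dotDl !(dot_u_frame p uv) !(dot_v_frame p uv) => /(_ uv1) l1 l2 l3.
  split; [move: l3|move: l2|move: l1].
  + by move=> l3; rewrite -(ltrD2l (dot u p)); apply: l3 => r [*]; rewrite (dot_u_frame p uv); lra.
  + by move=> l2; rewrite -(ltrD2l (dot v p)); apply: l2 => r [*]; rewrite (dot_v_frame p uv); lra.
  + move=> l1; have /l1 : forall r, tri true c s r ->
      dot (- (u + v)) (frame p u v r) <= - dot u p - dot v p - (c.1 + c.2 - s).
      by move=> r [*]; rewrite dotNl dotDl (dot_u_frame p uv) (dot_v_frame p uv); lra.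
    lra.
- have := lt (- u) (- dot u p - c.1); have := lt (- v) (- dot v p - c.2).
  have := lt (u + v) (dot u p + dot v p + (c.1 + c.2 + s)) uv1.
  rewrite !oppr_eq0 !dotNl dotDl !(dot_u_frame p uv) !(dot_v_frame p uv) => l1 /(_ v0) l2 /(_ u0) l3; split.
  + have /l3 : forall r, tri false c s r ->
      dot (- u) (frame p u v r) <= - dot u p - c.1.
      by move=> r [*]; rewrite dotNl (dot_u_frame p uv); lra.
    lra.
  + have /l2 : forall r, tri false c s r ->
      dot (- v) (frame p u v r) <= - dot v p - c.2.
      by move=> r [*]; rewrite dotNl (dot_v_frame p uv); lra.
    lra.
  + have /l1 : forall r, tri false c s r ->
      dot (u + v) (frame p u v r) <= dot u p + dot v p + (c.1 + c.2 + s).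
      by move=> r [*]; rewrite dotDl (dot_u_frame p uv) (dot_v_frame p uv); lra.
    lra.
Qed.

End FrameGeometry.

(** * Normal form of the square and of the triangles *)
Lemma frame_square_swap {R : realType} (p u v : plane R) :
  frame p u v @` std_square = frame p v u @` std_square.
Proof.
have half (u' v' : plane R) :
    frame p u' v' @` std_square `<=` frame p v' u' @` std_square.
  move=> _ [q [q1 q2] <-]; exists (q.2, q.1) => //.
  by rewrite !frameE; apply: plane_eq => /=; ring.
by apply/seteqP; split; exact: half.
Qed.

Lemma orthonormal_aligned {R : realType} (u v u' v' : plane R) :
  orthonormal u v -> orthonormal u' v' -> dot v u' = 0 ->
  exists al be : bool, u' = (if al then - u else u) /\ v' = (if be then - v else v).
Proof.
move=> uv uv' vu'; have [uu' vv' uv0'] := uv'.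
have sgn (a : R) : a * a = 1 -> a = 1 \/ a = -1.
  move=> aa; have : (a - 1) * (a + 1) = 0 by rewrite mulrDr mulrBl mulrBl aa; ring.
  by move/eqP; rewrite mulf_eq0 => /orP[/eqP ?|/eqP ?]; [left|right]; lra.
have ue : u' = dot u u' *: u.
  rewrite -[LHS](coordsK 0 uv) /coords subr0 vu' frameE.
  by apply: plane_eq; rewrite /= /GRing.scale /=; ring.
have aa : dot u u' * dot u u' = 1.
  move: uu'; rewrite {1}ue => <-.
  by rewrite /dot /= /GRing.scale /=; ring.
have a0 : dot u u' != 0.
  by apply: contra_eq_neq aa => ->; rewrite mul0r eq_sym oner_neq0.
have uv'0 : dot u v' = 0.
  apply: (mulfI a0); rewrite mulr0 -[RHS]uv0' {2}ue.
  by rewrite /dot /= /GRing.scale /=; ring.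
have ve : v' = dot v v' *: v.
  rewrite -[LHS](coordsK 0 uv) /coords subr0 uv'0 frameE.
  by apply: plane_eq; rewrite /= /GRing.scale /=; ring.
have bb : dot v v' * dot v v' = 1.
  move: vv'; rewrite {1}ve => <-.
  by rewrite /dot /= /GRing.scale /=; ring.
have [a1|a1] := sgn _ aa; have [b1|b1] := sgn _ bb;
  rewrite ue ve a1 b1 ?scale1r ?scaleN1r.
- by exists false, false.
- by exists false, true.
- by exists true, false.
- by exists true, true.
Qed.

(** A frame aligned with the sides of the square differs from the given one by
    the order and the signs of its axes; reversing an axis only changes the
    vertex of the square that serves as origin. *)
Lemma square_reframe {R : realType} (p u v u' v' : plane R) :
  orthonormal u v -> orthonormal u' v' -> dot u u' = 0 \/ dot v u' = 0 ->
  exists p', frame p u v @` std_square = frame p' u' v' @` std_square.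
Proof.
move=> uv uv'; wlog vu' : u v uv / dot v u' = 0.
  move=> wl [uu'|vu']; last by exact: (wl u v uv vu' (or_intror vu')).
  rewrite frame_square_swap.
  exact: (wl v u (orthonormal_swap uv) uu' (or_intror uu')).
move=> _; have [al [be [-> ->]]] := orthonormal_aligned uv uv' vu'.
pose fl (b : bool) (x : R) := if b then 1 - x else x.
exists (frame p u v (fl al 0, fl be 0)).
have e q : frame p u v q =
    frame (frame p u v (fl al 0, fl be 0)) (if al then - u else u)
      (if be then - v else v) (fl al q.1, fl be q.2).
  by rewrite /fl !frameE; case: (al); case: (be); apply: plane_eq => /=; ring.
have fl01 b x : 0 <= x <= 1 -> 0 <= fl b x <= 1.
  by rewrite /fl; case: b => // /andP[? ?]; apply/andP; split; lra.
have flK b x : fl b (fl b x) = x by rewrite /fl; case: b => //; ring.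
apply/seteqP; split=> _ [q [q1 q2] <-].
- by exists (fl al q.1, fl be q.2); [split; apply: fl01|rewrite -e].
- exists (fl al q.1, fl be q.2); first by split; apply: fl01.
  by rewrite e /= !flK; case: (q).
Qed.

(** The frame is spanned by the normalized legs of the triangle: one leg is
    orthogonal to a side of the square, and so the frame is aligned with the
    square. *)
Lemma along_normal_form {R : realType} (I T : set (plane R)) :
  unit_square I -> isosceles_right_triangle_along I T ->
  exists p u v c (L : R), [/\ orthonormal u v, 0 < L,
    I = frame p u v @` std_square & T = frame p u v @` tri false c L].
Proof.
move=> [p0 [u0 [v0 [uu0 vv0 uv0 Ie]]]].
have uv00 : orthonormal u0 v0 by [].
have {}Ie : I = frame p0 u0 v0 @` std_square.
  rewrite Ie; apply/seteqP; split=> x /=.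
    by move=> [s [t [hs ht ->]]]; exists (s, t).
  by move=> [q [q1 q2] <-]; exists q.1, q.2.
move=> [a [b [c [[ab legs0 legs] Te + _]]]]; rewrite Ie.
move=> /(has_side_parallel_square uv00) par.
have f0 : 0 < dot (b - a) (b - a).
  rewrite lt_def; apply/andP; split; last first.
    by rewrite /dot; apply: addr_ge0; rewrite -expr2 sqr_ge0.
  apply: contra ab; rewrite /dot paddr_eq0 -?expr2 ?sqr_ge0 // !sqrf_eq0.
  rewrite !subr_eq0 => /andP[/eqP h1 /eqP h2].
  by apply/eqP/esym; apply: plane_eq.
pose L := Num.sqrt (dot (b - a) (b - a)).
have L0 : 0 < L by rewrite sqrtr_gt0.
have LL : L * L = dot (b - a) (b - a) by rewrite -expr2 sqr_sqrtr // ltW.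
have dotZ (k l : R) (x y : plane R) : dot (k *: x) (l *: y) = k * l * dot x y.
  by rewrite /dot /= /GRing.scale /=; ring.
have L1 : L^-1 * L^-1 * (L * L) = 1.
  by rewrite mulrACA mulVf ?gt_eqF // mul1r.
have uv : orthonormal (L^-1 *: (b - a)) (L^-1 *: (c - a)).
  by split; rewrite dotZ -?legs ?legs0 ?mulr0 // -LL.
have par' : dot u0 (L^-1 *: (b - a)) = 0 \/ dot v0 (L^-1 *: (b - a)) = 0.
  by rewrite -[u0]scale1r -[v0]scale1r !dotZ; case: par => ->; rewrite mulr0; [left|right].
have [p ->] := square_reframe p0 uv00 uv par'.
move: uv {par par'}; set u := L^-1 *: (b - a); set v := L^-1 *: (c - a) => uv.
have [a' ca] : exists a', frame p u v a' = a.
  by exists (coords p u v a); exact: coordsK.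
exists p, u, v, a', L; split => //.
have bu : b - a = L *: u by rewrite scalerA divff ?gt_eqF // scale1r.
have cv : c - a = L *: v by rewrite scalerA divff ?gt_eqF // scale1r.
have fr s t : a + s *: (b - a) + t *: (c - a) =
    frame p u v (a'.1 + L * s, a'.2 + L * t).
  rewrite bu cv -{1}ca !frameE.
  by apply: plane_eq; rewrite /= /GRing.scale /=; ring.
rewrite Te; apply/seteqP; split=> x /=.
- move=> [s [t [s0 t0 st ->]]]; rewrite fr; eexists; last by [].
  by split => /=; nra.
- move=> [q [/= q1 q2 q3] <-]; exists ((q.1 - a'.1) / L), ((q.2 - a'.2) / L).
  split.
  + by rewrite divr_ge0 ?subr_ge0 // ltW.
  + by rewrite divr_ge0 ?subr_ge0 // ltW.
  + by rewrite -mulrDl ler_pdivrMr // mul1r; lra.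
  + rewrite fr !(mulrC L) !divfK ?gt_eqF //; congr frame.
    by apply: plane_eq => /=; ring.
Qed.

(** A homothety with negative ratio exchanges the two orientations. *)
Lemma homothety_frame_tri {R : realType} (p u v c : plane R) (L k : R)
    (w : plane R) : orthonormal u v -> k != 0 ->
  exists c', [set k *: x + w | x in frame p u v @` tri false c L] =
    frame p u v @` tri (k < 0) c' (`|k| * L).
Proof.
move=> uv k0.
have [z cz] : exists z, frame p u v z = k *: p + w.
  by exists (coords p u v (k *: p + w)); exact: coordsK.
have fr q : k *: frame p u v q + w = frame p u v (k * q.1 + z.1, k * q.2 + z.2).
  transitivity ((k * q.1) *: u + (k * q.2) *: v + (k *: p + w)).
    by rewrite !frameE; apply: plane_eq; rewrite /= /GRing.scale /=; ring.
  by rewrite -cz !frameE; apply: plane_eq; rewrite /= /GRing.scale /=; ring.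
have inv (x y : R) : k * ((x - y) / k) + y = x by rewrite mulrC divfK // subrK.
exists (k * c.1 + z.1, k * c.2 + z.2).
apply/seteqP; split=> x /=.
- move=> [_ [q [/= q1 q2 q3] <-] <-]; rewrite fr; eexists; last by [].
  have [kn|kp|k00] := ltgtP k 0; last by rewrite k00 eqxx in k0.
  + by rewrite (ltr0_norm kn); split => /=; nra.
  + by rewrite (gtr0_norm kp); split => /=; nra.
- move=> [r rt <-]; exists (frame p u v ((r.1 - z.1) / k, (r.2 - z.2) / k)); last first.
    by rewrite fr /= !inv; case: (r).
  eexists; last by [].
  have r1 := inv r.1 z.1; have r2 := inv r.2 z.2.
  set y1 := (r.1 - z.1) / k in r1 *; set y2 := (r.2 - z.2) / k in r2 *.
  move: rt; have [kn|kp|k00] := ltgtP k 0; last by rewrite k00 eqxx in k0.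
  + rewrite (ltr0_norm kn) => -[/= h1 h2 h3]; split => /=.
    * by rewrite -(ler_nM2l kn); lra.
    * by rewrite -(ler_nM2l kn); lra.
    * by rewrite -(ler_nM2l kn); lra.
  + rewrite (gtr0_norm kp) => -[/= h1 h2 h3]; split => /=.
    * by rewrite -(ler_pM2l kp); lra.
    * by rewrite -(ler_pM2l kp); lra.
    * by rewrite -(ler_pM2l kp); lra.
Qed.

(** A translation matches the right angles if the orientations agree; otherwise
    the half turn about the midpoint of the two right angles does. *)
Lemma move_tri {R : realType} (p u v : plane R) up up' (c c' : plane R) (s : R) :
  exists f, (translation f \/ half_turn f) /\
    f @` (frame p u v @` tri up c s) = frame p u v @` tri up' c' s.
Proof.
have [->|upN] := eqVneq up up'.
  exists (fun x => x + ((c'.1 - c.1) *: u + (c'.2 - c.2) *: v)).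
  split; first by left; eexists.
  have fr q : frame p u v q + ((c'.1 - c.1) *: u + (c'.2 - c.2) *: v) =
      frame p u v (q.1 + (c'.1 - c.1), q.2 + (c'.2 - c.2)).
    by rewrite !frameE; apply: plane_eq; rewrite /= /GRing.scale /=; ring.
  apply/seteqP; split=> x /=.
    move=> [_ [q qt <-] <-]; rewrite fr; eexists; last by [].
    by move: qt; case: (up') => -[/= ? ? ?]; split => /=; lra.
  move=> [q qt <-]; exists (frame p u v (q.1 - (c'.1 - c.1), q.2 - (c'.2 - c.2))).
    eexists; last by [].
    by move: qt; case: (up') => -[/= ? ? ?]; split => /=; lra.
  by rewrite fr /= !subrK; case: (q).
pose m := frame p u v ((c.1 + c'.1) / 2, (c.2 + c'.2) / 2).
exists (fun x => m - (x - m)); split; first by right; exists m.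
have fr q : m - (frame p u v q - m) =
    frame p u v (c.1 + c'.1 - q.1, c.2 + c'.2 - q.2).
  by rewrite /m !frameE; apply: plane_eq => /=; field.
apply/seteqP; split=> x /=.
  move=> [_ [q qt <-] <-]; rewrite fr; eexists; last by [].
  by move: upN qt; case: (up); case: (up') => // _ [/= ? ? ?]; split => /=; lra.
move=> [q qt <-]; exists (frame p u v (c.1 + c'.1 - q.1, c.2 + c'.2 - q.2)).
  eexists; last by [].
  by move: upN qt; case: (up); case: (up') => // _ [/= ? ? ?]; split => /=; lra.
by rewrite fr /=; congr frame; apply: plane_eq => /=; ring.
Qed.

(** * The packing theorem *)
Lemma square_parallel_packable {R : realType} (p u v c : plane R) (L : R)
    (a b : plane R) (K : set nat) (T_ : nat -> set (plane R)) :
  orthonormal u v -> 0 < L -> side (frame p u v @` std_square) a b ->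
  (forall n, K n -> homothetic_copy (frame p u v @` tri false c L) (T_ n)) ->
  (\esum_(n in K) area (T_ n) <= (1 / 2)%:E)%E ->
  parallel_packable (frame p u v @` std_square) a b K T_.
Proof.
move=> uv L0 base hT area_le.
have /choice[g gP] n : exists g : R * bool * plane R, K n ->
    0 < g.1.1 /\ T_ n = frame p u v @` tri g.1.2 g.2 g.1.1.
  have [Kn|nK] := pselect (K n); last by exists (0, true, 0).
  have [k [w [k0 ->]]] := hT n Kn.
  have [c' ->] := homothety_frame_tri p c L w uv k0.
  by exists (`|k| * L, k < 0, c') => _; rewrite mulr_gt0 ?normr_gt0.
pose s n := (g n).1.1.
have [t [rho [tD tb trho rho_inj]]] : exists (t : nat -> R) (rho : nat -> nat),
    [/\ descending t, sqsum_le t 1, forall n, K n -> t (rho n) = s n &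
        forall m n, K m -> K n -> rho m = rho n -> m = n].
  apply: sorted_rearrangement => //; first by move=> n /gP[].
  move=> r ru rK.
  suff : ((\sum_(n <- r) s n ^+ 2 / 2)%:E <= (1 / 2)%:E :> \bar R)%E.
    by rewrite lee_fin -mulr_suml ler_pM2r // invr_gt0 ltr0n.
  apply: le_trans area_le; apply: esum_ge; exists [set` r].
    by split; [exact: finite_seq|exact: rK].
  rewrite -fsbig_seq // -sumEFin big_seq [leRHS]big_seq.
  apply: lee_sum => n /rK/gP[sn ->].
  by rewrite area_frame_tri.
have [ups [cs [sub dis]]] := square_packs tD tb.
have /choice[lam lamP] n : exists f, (translation f \/ half_turn f) /\
    f @` (frame p u v @` tri (g n).1.2 (g n).2 (s n)) =
    frame p u v @` tri (ups (rho n)) (cs (rho n)) (s n).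
  exact: move_tri.
have lamE n : K n -> lam n @` T_ n =
    frame p u v @` tri (ups (rho n)) (cs (rho n)) (t (rho n)).
  by move=> Kn; have [_ ->] := gP n Kn; rewrite (lamP n).2 trho.
exists lam; split.
- by move=> n _; have [] := lamP n.
- move=> n Kn; rewrite lamE // => _ [q qt <-]; exists q => //.
  exact: (sub (rho n)).
- move=> m n Km Kn [x]; rewrite !lamE // => -[/(interior_tri uv)[q qm <-]].
  move=> /(interior_tri uv)[q' qn /(can_inj (frameK p uv)) E].
  move: qn; rewrite {}E => qn; apply: rho_inj => //.
  have open_sub up' (c' : plane R) r : open_tri up' c' r `<=` tri up' c' r.
    by case: up' => y [/= h1 h2 h3]; split; apply: ltW.
  have [lt|lt|//] := ltngtP (rho m) (rho n).
    by case: (dis _ _ lt q qm); apply: open_sub.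
  by case: (dis _ _ lt q qn); apply: open_sub.
- move=> n Kn; rewrite lamE //; apply: has_side_parallel_tri => //.
    by rewrite trho //; have [] := gP n Kn.
  exact: side_square base.
Qed.

(** If [r > 1/2], the triangle of leg [S = sqrt(2r) > 1] has area [r].  Two
    vertices of any of its copies differ by [S] in the first coordinate, and so
    they cannot both lie in the square. *)
Lemma square_density_le {R : realType} (p u v c : plane R) (L : R)
    (a b : plane R) (r : R) : orthonormal u v -> 0 < L ->
  packing_densities (frame p u v @` std_square) a b
    (frame p u v @` tri false c L) r -> r <= 1 / 2.
Proof.
move=> uv L0 hr; rewrite leNgt; apply/negP => r2.
pose S := Num.sqrt (2 * r).
have SS : S ^+ 2 = 2 * r by rewrite sqr_sqrtr //; lra.
have S1 : 1 < S.
  by rewrite -(ltr_pXn2r (ltn0Sn 1)) ?nnegrE ?sqrtr_ge0 // SS expr1n; lra.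
have S0 : 0 < S by lra.
pose k := S / L.
have kL : k * L = S by rewrite divfK // gt_eqF.
have k0 : 0 < k by rewrite divr_gt0.
have [c' Ce] := homothety_frame_tri p c L 0 uv (lt0r_neq0 k0).
rewrite gtr0_norm // kL ltNge ltW //= in Ce.
have hC : homothetic_copy (frame p u v @` tri false c L)
    (frame p u v @` tri false c' S).
  by exists k, 0; rewrite gt_eqF.
have [] := hr [set 0%N] (fun=> frame p u v @` tri false c' S) => //.
  rewrite esum_set1; last by rewrite area_frame_tri // lee_fin SS; lra.
  rewrite area_frame_tri // area_frame_square // mule1 lee_fin SS; lra.
move=> lam [/(_ 0%N erefl) lam0 /(_ 0%N erefl) sub _ _].
have inI q : tri false c' S q -> exists2 q', std_square q' &
    frame p u v q' = lam 0%N (frame p u v q).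
  move=> qt; have [|q'] := sub (lam 0%N (frame p u v q)); last by exists q'.
  by exists (frame p u v q) => //; exists q.
have [r0 [/andP[x0 x1] _] r0e] : exists2 q, std_square q &
    frame p u v q = lam 0%N (frame p u v c').
  by apply: inI; split => //=; lra.
have [r1 [/andP[y0 y1] _] r1e] : exists2 q, std_square q &
    frame p u v q = lam 0%N (frame p u v (c'.1 + S, c'.2)).
  by apply: inI; split => /=; lra.
have [+ _] := dot_sub_frame p uv r1 r0; rewrite r0e r1e.
have [+ _] := dot_sub_frame p uv (c'.1 + S, c'.2) c' => /=.
set q0 := frame p u v c'; set q1 := frame p u v _; rewrite /dot /=.
by case: lam0 => -[w ->] /=; lra.
Qed.

Theorem theorem1 (R : realType) (I T : set (plane R)) (a b : plane R)
    (hI : unit_square I)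
    (hT : isosceles_right_triangle_along I T)
    (hbase : side I a b) :
  (forall (K : set nat) (T_ : nat -> set (plane R)),
     (forall n, K n -> homothetic_copy T (T_ n)) ->
     (\esum_(n in K) area (T_ n) <= (1 / 2)%:E)%E ->
     parallel_packable I a b K T_) /\
  is_varrho I a b T (1 / 2).
Proof.
have [p [u [v [c [L [uv L0 Ie Te]]]]]] := along_normal_form hI hT.
subst I T; split; last split.
- move=> K T_ hT_ area_le.
  exact: square_parallel_packable uv L0 hbase hT_ area_le.
- move=> K T_ hT_; rewrite area_frame_square // mule1 => area_le.
  exact: square_parallel_packable uv L0 hbase hT_ area_le.
- by move=> r; apply: square_density_le uv L0.
Qed.
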